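(* There is a universal constant $C>0$ such that for every probability space $(X,\mathcal{F},\mu)$ with $L^2(X,\mu)$ infinite dimensional, every reversible Markov operator $P$ on $L^2(X,\mu)$, and every $k\geq1$, \[ \frac{1}{C^2k^6}\bigl(1-\overline{h}_P(k)\bigr)^2\leq\overline{\lambda}_k\leq2\bigl(1-\overline{h}_P(k)\bigr). \]
   Context: A Markov operator is a linear operator $P:L^2(X,\mu)\to L^2(X,\mu)$ with $P1=1$ and $Pf\geq0$ whenever $f\geq0$; it is reversible if $\int_XgPf\,d\mu=\int_XfPg\,d\mu$ for all $f,g$. Write $(f,g)_\mu=\int_Xfg\,d\mu$ and $1_A$ for the indicator of $A$. Let $\overline{L}:=I+P$ and \[ \overline{\lambda}_k:=\sup_{f_1,\ldots,f_{k-1}\in L^2(X,\mu)}\ \inf_{\substack{f\neq0,\ (f,f_i)_\mu=0\ \forall i\leq k-1}}\frac{(f,\overline{L}f)_\mu}{(f,f)_\mu}. \] $\overline{h}_P(k):=\sup\min_{1\leq i\leq k}\frac{2(1_{A_{2i-1}},P1_{A_{2i}})_\mu}{\mu(A_{2i-1}\cup A_{2i})}$ over all collections of $k$ pairs of measurable sets $(A_1,A_2),\ldots,(A_{2k-1},A_{2k})$, pairwise disjoint, with $\mu(A_{2i-1}\cup A_{2i})>0$ for each $i$. *)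

(* Defs.v *)
From HB Require Import structures.
From mathcomp Require Import all_boot all_order all_algebra.
From mathcomp Require Import all_classical all_reals all_analysis.
Set Implicit Arguments. Unset Strict Implicit. Unset Printing Implicit Defensive.
Import Order.TTheory GRing.Theory Num.Theory.
Local Open Scope classical_set_scope.
Local Open Scope ring_scope.

Section Markov.
Context (d : measure_display) (T : measurableType d) (R : realType)
  (mu : probability T R).

Definition L2 (f : T -> R) : Prop :=
  measurable_fun setT f /\ mu.-integrable setT (fun x => (f x ^+ 2)%:E).

Definition ip (f g : T -> R) : R := Rintegral mu setT (fun x => f x * g x).

Definition L2_infinite_dim : Prop :=
  forall n : nat, exists fs : 'I_n -> T -> R,
    (forall i, L2 (fs i)) /\
    forall c : 'I_n -> R,
      {ae mu, forall x, \sum_(i < n) c i * fs i x = 0} -> forall i, c i = 0.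

(* A linear operator on L^2(X,mu), represented on representatives:
   it maps L^2 to L^2, respects a.e. equality, and is linear (mod a.e.). *)
Definition L2_linear_operator (P : (T -> R) -> (T -> R)) : Prop :=
  [/\ forall f, L2 f -> L2 (P f),
      forall f g, L2 f -> L2 g -> {ae mu, forall x, f x = g x} ->
        {ae mu, forall x, P f x = P g x} &
      forall (a : R) f g, L2 f -> L2 g ->
        {ae mu, forall x, P (fun y => a * f y + g y) x = a * P f x + P g x}].

Definition markov_operator (P : (T -> R) -> (T -> R)) : Prop :=
  [/\ L2_linear_operator P,
      {ae mu, forall x, P (fun _ => 1) x = 1} &
      forall f, L2 f -> {ae mu, forall x, 0 <= f x} ->
        {ae mu, forall x, 0 <= P f x}].

Definition reversible (P : (T -> R) -> (T -> R)) : Prop :=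
  forall f g, L2 f -> L2 g -> ip g (P f) = ip f (P g).

Definition rayleigh (P : (T -> R) -> (T -> R)) (f : T -> R) : R :=
  ip f (fun x => f x + P f x) / ip f f.

Definition lambdabar (P : (T -> R) -> (T -> R)) (k : nat) : \bar R :=
  ereal_sup [set ereal_inf
      [set (rayleigh P f)%:E | f in
        [set f | L2 f /\ ~ {ae mu, forall x, f x = 0} /\
                 forall i, ip f (fs i) = 0]]
    | fs in [set fs : 'I_k.-1 -> T -> R | forall i, L2 (fs i)]].

(* admissible collections of k pairs (A i, B i) = (A_{2i-1}, A_{2i}):
   all 2k sets measurable and pairwise disjoint, mu (A i `|` B i) > 0 *)
Definition admissible_pairs (k : nat) (A B : 'I_k -> set T) : Prop :=
  [/\ forall i, measurable (A i) /\ measurable (B i),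
      forall i j, i != j -> A i `&` A j = set0 /\ B i `&` B j = set0,
      forall i j, A i `&` B j = set0 &
      forall i, (0 < mu (A i `|` B i))%E].

Definition hbar (P : (T -> R) -> (T -> R)) (k : nat) : \bar R :=
  ereal_sup [set ereal_inf
      [set (2 * ip (\1_(AB.1 i)) (P (\1_(AB.2 i))) / fine (mu (AB.1 i `|` AB.2 i)))%:E
        | i in [set: 'I_k]]
    | AB in [set AB : ('I_k -> set T) * ('I_k -> set T) |
              admissible_pairs AB.1 AB.2]].

End Markov.

(* Main.v *)
(* Upper bound: given k pairs (A_i, B_i) and k - 1 constraints, some nonzero
   f = sum_i c_i (1_{A_i} - 1_{B_i}) satisfies the constraints, and bounding
   (f(x) + f(y))^2 by 2 f(x)^2 + 2 f(y)^2 off the pairs (where it vanishes) gives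
   (f, (I + P) f) <= 2 (1 - min_i ratio_i) (f, f).

   Lower bound: choosing near-minimizers of the Rayleigh quotient one after the
   other gives orthonormal f_1, ..., f_k with (f_i, (I + P) f_i) <= lambdabar_k + e,
   without any spectral theorem.  Simple functions close to the f_i live on a
   finite measurable partition, where P becomes a symmetric weight w and
   F = (f_1, ..., f_k) a map from a finite graph to R^k with
   sum w(x, y) |F(x) + F(y)|^2 <= 2 k lambda.  Cut the directions F/|F| by a
   randomly shifted grid of side 1/(8k) that is symmetric under negation.  By
   isotropy, a pair of opposite cells carries at most 1 + 1/(4k) of the total mass
   k of |F|^2, so the pairs of cells can be grouped into k groups of mass >= 1/2.
   A good shift makes the weight of the edges (x, y) for which F(x) and -F(y) lie in
   different cells O(k^3 sqrt lambda), and a layer-cake argument in each group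
   yields a level set of |F|^2 whose two antipodal halves form the required pair. *)
Require Import Defs.
From Stdlib Require Import Reals.
From HB Require Import structures.
From mathcomp Require Import all_boot all_order all_algebra.
From mathcomp Require Import all_classical all_reals all_analysis.
From mathcomp Require Import Rstruct Rstruct_topology.
From mathcomp Require Import measurable_realfun ring lra.
Set Implicit Arguments. Unset Strict Implicit. Unset Printing Implicit Defensive.
Import Order.TTheory GRing.Theory Num.Theory.
Import numFieldNormedType.Exports.
Local Open Scope ring_scope.

(** * Odd quantizers with a random shift *)

Section Quantizer.
Variable R : realType.

(** Moving [z] by [1/m] turns each shift [i/m] into the next one; the last wraps around to the first
    with its floor raised by 1, so the sum gains exactly 1. *)
Lemma sum_floor_shift (m : nat) (z : R) : (0 < m)%N ->
  \sum_(i < m) (Num.floor (z + m%:R^-1 + i%:R / m%:R))%:~R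
  = \sum_(i < m) (Num.floor (z + i%:R / m%:R))%:~R + 1 :> R.
Proof.
move=> m0; pose a (i : nat) : R := (Num.floor (z + i%:R / m%:R))%:~R.
have m0' : m%:R != 0 :> R by rewrite pnatr_eq0 -lt0n.
have am : a m = a 0%N + 1.
  by rewrite /a divff // mul0r addr0 floorDrz ?rpred1 // floor1 intrD.
have /eqP : \sum_(i < m) a i + a m = a 0%N + \sum_(i < m) a (lift ord0 i).
  by rewrite -(@big_ord_recr _ 0 +%R m (fun i => a i)) (@big_ord_recl _ 0 +%R m (fun i => a i)).
rewrite am => /eqP H.
rewrite (eq_bigr (fun i : 'I_m => a (lift ord0 i))); last first.
  move=> i _; rewrite /a lift0 -[i.+1]add1n natrD mulrDl div1r addrA //.
by move: H; rewrite /a /=; lra.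
Qed.

(** Discrete form of the fact that a randomly shifted unit grid separates two points with
    probability at most their distance. The summed floor [Phi] grows by 1 per step [1/m], and when
    [x <= y] every separating shift adds at least 1 to [Phi y - Phi x]. *)
Lemma count_floor_neq (m : nat) (x y : R) : (0 < m)%N ->
  \sum_(i < m)
    (Num.floor (x + i%:R / m%:R) != Num.floor (y + i%:R / m%:R))%:R
  <= m%:R * `|x - y| + 1 :> R.
Proof.
move=> m0; wlog xy : x y / x <= y => [H|].
  have [/H//|/ltW/H] := leP x y.
  by rewrite distrC; under eq_bigr do rewrite eq_sym.
have mp : 0 < m%:R :> R by rewrite ltr0n.
pose Phi (z : R) : R := \sum_(i < m) (Num.floor (z + i%:R / m%:R))%:~R.
have Phin (n : nat) : Phi (x + n%:R / m%:R) = Phi x + n%:R.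
  elim: n => [|n IH]; first by rewrite mul0r !addr0.
  have -> : x + n.+1%:R / m%:R = x + n%:R / m%:R + m%:R^-1.
    by rewrite -[n.+1]addn1 natrD mulrDl div1r addrA.
  by rewrite /Phi sum_floor_shift // -/(Phi _) IH -[n.+1]addn1 natrD addrA.
(* [n] steps of length [1/m] lead from [x] to [y] or beyond; rounding up costs the final [+ 1]. *)
have [n /andP[n1 n2]] : exists n : nat, m%:R * (y - x) <= n%:R <= m%:R * (y - x) + 1.
  exists (Num.truncn (m%:R * (y - x))).+1.
  have /truncn_itv : 0 <= m%:R * (y - x) by rewrite mulr_ge0 ?subr_ge0 // ltW.
  by move=> /andP[h1 /ltW ->]/=; rewrite -[_.+1]addn1 natrD lerD2r.
have mono (z t : R) : z <= t -> Phi z <= Phi t.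
  move=> zt; apply: ler_sum => i _; rewrite ler_int le_floor //.
  by rewrite lerD2r.
have : Phi y <= Phi x + n%:R.
  rewrite -Phin; apply: mono; rewrite -lerBlDl ler_pdivlMr // mulrC //.
suff : \sum_(i < m)
    (Num.floor (x + i%:R / m%:R) != Num.floor (y + i%:R / m%:R))%:R <= Phi y - Phi x.
  by rewrite distrC ger0_norm ?subr_ge0 //; lra.
rewrite /Phi -sumrB; apply: ler_sum => i _.
rewrite -intrB; set p := Num.floor _; set q := Num.floor _.
have pq : p <= q by apply: le_floor; rewrite lerD2r.
have [->|ne] := eqVneq p q; first by rewrite subrr.
rewrite -[true%:R]/(1%:~R) ler_int -gtz0_ge1 subr_gt0 lt_neqAle ne pq //.
Qed.

(** The shifted grid is cut on the nonnegative half-line and reflected, so that negation permutes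
    the cells; for [0 <= a < 1] the two pieces next to 0 merge into one cell of index 0. *)
Definition quantize (a t : R) : int :=
  if 0 <= t then Num.floor (t + a) else - Num.floor (- t + a).

Lemma quantize_abs a t : quantize a t =
  if 0 <= t then Num.floor (`|t| + a) else - Num.floor (`|t| + a).
Proof. by rewrite /quantize; case: ger0P => // /ltr0_norm ->. Qed.

Lemma floor_itv01 (a : R) : 0 <= a < 1 -> Num.floor a = 0.
Proof. by move=> h; apply/eqP; rewrite floor_eq add0r. Qed.

Lemma quantizeN a t : 0 <= a < 1 -> quantize a (- t) = - quantize a t.
Proof.
move=> ha; rewrite /quantize oppr_ge0 opprK; case: ltrgtP => [t0|t0|->].
- by rewrite opprK.
- by [].
- by rewrite oppr0 add0r floor_itv01 // oppr0.
Qed.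

Lemma quantize_eq0 a t : 0 <= a -> quantize a t = 0 -> `|t| < 1.
Proof.
move=> ha; rewrite quantize_abs => h.
have /eqP : Num.floor (`|t| + a) = 0 by move: h; case: ifP => _ // /eqP; rewrite oppr_eq0 => /eqP.
rewrite floor_eq => /andP[_]; rewrite add0r => h2; apply: le_lt_trans h2.
by rewrite lerDl.
Qed.

(** Ordinary cells have length at most 1; the bound is 2 because the cell of index 0 can reach out
    by 1 on both sides of 0. *)
Lemma quantize_close a t t' : 0 <= a -> quantize a t = quantize a t' -> `|t - t'| < 2.
Proof.
move=> ha; rewrite /quantize.
have same (x y : R) : Num.floor x = Num.floor y -> `|x - y| < 1.
  move=> e; have := floor_itv x; have := floor_itv y; rewrite e intrD.
  by move=> /andP[? ?] /andP[? ?]; rewrite ltr_norml; lra.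
have small (x y : R) : 0 <= x -> 0 <= y -> Num.floor x = - Num.floor y -> x < 1.
  move=> x0 y0 e; have /eqP : Num.floor x = 0.
    have : 0 <= Num.floor x by rewrite floor_ge0.
    have : 0 <= Num.floor y by rewrite floor_ge0.
    rewrite e => h1 h2; apply/eqP; rewrite eq_le h2 andbT oppr_le0 //.
  by rewrite floor_eq add0r => /andP[].
case: (lerP 0 t) => t0; case: (lerP 0 t') => t'0.
- by move=> /same; rewrite !ltr_norml; lra.
- move=> e; have := small _ _ _ _ e; have := small _ _ _ _ (canRL opprK (esym e)).
  move=> h1 h2; rewrite ltr_norml; have := h1 _ _; have := h2 _ _; lra.
- move=> /esym e; have := small _ _ _ _ e; have := small _ _ _ _ (canRL opprK (esym e)).
  move=> h1 h2; rewrite ltr_norml; have := h1 _ _; have := h2 _ _; lra.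
- by move=> /oppr_inj/same; rewrite !ltr_norml; lra.
Qed.

Lemma count_quantize_neq (m : nat) (x y : R) : (0 < m)%N ->
  \sum_(i < m) (quantize (i%:R / m%:R) x != quantize (i%:R / m%:R) y)%:R
  <= m%:R * `|x - y| + 2 :> R.
Proof.
move=> m0; wlog : x y / x <= y => [H|].
  have [/H//|/ltW/H] := leP x y.
  by rewrite distrC; under eq_bigr do rewrite eq_sym.
have mp : 0 < m%:R :> R by rewrite ltr0n.
have im (i : 'I_m) : 0 <= (i%:R / m%:R : R) < 1.
  by rewrite divr_ge0 //= ltr_pdivrMr // mul1r ltr_nat.
rewrite /quantize; case: (lerP 0 x) => x0; case: (lerP 0 y) => y0 xy.
- by apply: le_trans (count_floor_neq _ _ m0) _; rewrite lerD2l ler1n.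
- lra.
(* When [x < 0 <= y], a shift separating [x] from [y] separates 0 from [- x] or 0 from [y]; adding
   the two counts gives the constant 2. *)
- have h1 := count_floor_neq 0 (- x) m0; have h2 := count_floor_neq 0 y m0.
  have nx : `|0 - - x| = - x by rewrite sub0r opprK ltr0_norm.
  have ny : `|0 - y| = y by rewrite sub0r normrN ger0_norm.
  have nxy : `|x - y| = y - x by rewrite distrC ger0_norm // subr_ge0.
  rewrite nx in h1; rewrite ny in h2; rewrite nxy.
  have h := lerD h1 h2; rewrite -big_split /= in h.
  have -> : m%:R * (y - x) + 2 = m%:R * - x + 1 + (m%:R * y + 1) :> R by ring.
  apply: le_trans h.
  apply: ler_sum => i _ /=; rewrite !add0r (floor_itv01 (im i)).
  set p := Num.floor (- x + _); set q := Num.floor (y + _).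
  have b01 (b : bool) : 0 <= (b%:R : R) <= 1 by case: b; rewrite ?lexx ?ler01.
  have [p0|p0] := eqVneq 0 p; last first.
    have /andP[_ ] := b01 (- p != q); have /andP[+ _] := b01 (0 != q); rewrite /=; lra.
  by rewrite -p0 oppr0 add0r.
- apply: le_trans (le_trans (count_floor_neq (- x) (- y) m0) _); last first.
    by rewrite -opprD normrN lerD2l ler1n.
  by apply: ler_sum => i _; rewrite eqr_opp.
Qed.
End Quantizer.

(** * Layer cake and greedy grouping *)

(** The functional is additive over the layers of [g], since [Num.min] is. If it is positive at [g],
    it is positive at the indicator of some superlevel set. The induction is on the size of the
    support of [g]. *)
Lemma layer_cake (R : realDomainType) (V : finType) (c : V -> R)
    (b : V -> V -> R) (g : V -> R) : (forall x, 0 <= g x) ->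
  0 < \sum_x c x * g x + \sum_x \sum_y b x y * Num.min (g x) (g y) ->
  exists S : {set V}, (forall x, x \in S -> 0 < g x) /\
    0 < \sum_(x in S) c x + \sum_(x in S) \sum_(y in S) b x y.
Proof.
move: {2}#|_| (leqnn #|[set x | 0 < g x]|) => n.
elim: n g => [|n IH] g hn g0 gpos.
  have gz x : g x = 0.
    move: hn; rewrite leqn0 cards_eq0 => /eqP/finset.setP/(_ x); rewrite !inE.
    by rewrite lt_def g0 andbT => /negbFE/eqP.
  move: gpos; rewrite big1 ?add0r => [|x _]; last by rewrite gz mulr0.
  rewrite big1 ?ltxx // => x _; rewrite big1 // => y _.
  by rewrite !gz minxx mulr0.
pose S := [set x | 0 < g x].
have [S0|/set0Pn[x0 x0S]] := eqVneq S finset.set0.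
  by apply: IH => //; rewrite -/S S0 cards0.
pose x1 := [arg min_(x < x0 in S) g x]%O.
have [x1S x1min] : x1 \in S /\ forall x, x \in S -> g x1 <= g x.
  by rewrite /x1; case: arg_minP => // i iS h; split.
have a0 : 0 < g x1 by move: x1S; rewrite inE.
(* Peel off the bottom layer: [g] is [g'] plus the least positive value [g x1] times the indicator
   of the support [S], and [g'] vanishes at [x1]. *)
pose g' x := if x \in S then g x - g x1 else 0.
have gE x : g x = g' x + g x1 * (x \in S)%:R.
  rewrite /g'; case: ifPn => [_|]; first by rewrite mulr1 subrK.
  by rewrite inE lt_def g0 andbT negbK mulr0 addr0 => /eqP.
have g'0 x : 0 <= g' x by rewrite /g'; case: ifP => // /x1min; rewrite subr_ge0.
have minE x y : Num.min (g x) (g y) =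
    Num.min (g' x) (g' y) + g x1 * (x \in S)%:R * (y \in S)%:R.
  have [xS|xS] := boolP (x \in S); have [yS|yS] := boolP (y \in S).
  - by rewrite [g x]gE [g y]gE xS yS !mulr1 addr_minl.
  - rewrite [g y]gE (negPf yS) /g' xS (negPf yS) !mulr0 !addr0 !min_r //.
    by rewrite subr_ge0 x1min.
  - rewrite [g x]gE (negPf xS) /g' yS (negPf xS) !mulr0 mul0r !addr0 !min_l //.
    by rewrite subr_ge0 x1min.
  - by rewrite [g x]gE [g y]gE /g' (negPf xS) (negPf yS) !mulr0 !addr0.
have E1 : \sum_x c x * g x = \sum_x c x * g' x + g x1 * \sum_(x in S) c x.
  rewrite mulr_sumr [X in _ + X]big_mkcond -big_split /=; apply: eq_bigr => x _.
  by rewrite {1}gE; case: ifP => _; rewrite ?mulr1 ?mulr0 ?addr0 // mulrDr (mulrC (g x1)).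
have E2 : \sum_x \sum_y b x y * Num.min (g x) (g y) =
    \sum_x \sum_y b x y * Num.min (g' x) (g' y)
    + g x1 * \sum_(x in S) \sum_(y in S) b x y.
  rewrite mulr_sumr [X in _ + X]big_mkcond -big_split /=; apply: eq_bigr => x _.
  case: ifPn => xS.
    rewrite mulr_sumr [X in _ + X]big_mkcond -big_split /=; apply: eq_bigr => y _.
    rewrite minE xS mulr1.
    by case: ifP => _; rewrite ?mulr1 ?mulr0 ?addr0 // mulrDr (mulrC (g x1)).
  rewrite addr0; apply: eq_bigr => y _.
  by rewrite minE (negPf xS) mulr0 mul0r addr0.
have [SP|SN] := ltrP 0 (\sum_(x in S) c x + \sum_(x in S) \sum_(y in S) b x y).
  by exists S; split => // x; rewrite inE.
have [|//||S' [S'1 S'2]] := IH g' _ _.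
- rewrite -ltnS; apply: leq_trans hn; apply: proper_card.
  apply/properP; split.
    by apply/fintype.subsetP => x; rewrite !inE /g'; case: ifP; rewrite ?ltxx // inE.
  by exists x1; rewrite ?inE // /g' x1S subrr ltxx.
- move: gpos; rewrite E1 E2 addrACA -mulrDr => /lt_le_trans; apply.
  by rewrite gerDl pmulr_rle0.
exists S'; split => // x /S'1; rewrite /g'; case: ifP; rewrite ?ltxx //.
by rewrite inE.
Qed.

(** Groups are split off one at a time; each has mass at most [b], so the mass left suffices for the
    remaining ones. The summand [b] on the right stands for [(k - 1) * b] on the left and keeps the
    case [k = 0] meaningful. *)
Lemma greedy_grouping (R : realFieldType) (I : finType) (m : I -> R) (b : R) :
  1 <= b -> (forall i, 0 <= m i <= b) ->
  forall (k : nat) (D : {set I}), k%:R * b + 1 / 2 <= \sum_(i in D) m i + b ->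
  exists G : 'I_k -> {set I}, [/\ forall j, G j \subset D,
    forall i j, i != j -> [disjoint G i & G j] &
    forall j, 1 / 2 <= \sum_(i in G j) m i].
Proof.
move=> b1 mb; elim=> [|k IH] D hD.
  by exists (fun=> finset.set0); split=> [[]|[]|[]].
pose p (A : {set I}) := 1 / 2 <= \sum_(i in A) m i.
have pD : p D.
  have : 0 <= k%:R * b by rewrite mulr_ge0 //; lra.
  by rewrite /p; move: hD; rewrite -[k.+1]addn1 natrD mulrDl mul1r; lra.
have [A /minsetP[pA Amin] AD] := minset_exists pD.
(* By minimality, either [A] is a single element, of mass at most [b], or any element and its
   complement in [A] both have mass below [1 / 2], so that [A] has mass below [1 <= b]. *)
have Ab : \sum_(i in A) m i <= b.
  have [A0|/set0Pn[a aA]] := eqVneq A finset.set0.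
    by rewrite A0 big_set0; lra.
  have [/Amin e|na] := boolP (p [set a]).
    rewrite -(e _) ?big_set1; first by have /andP[] := mb a.
    by rewrite finset.sub1set.
  have [/Amin e|nA] := boolP (p (A :\ a)).
    have := e (finset.subD1set _ _) => /finset.setP/(_ a); rewrite !inE eqxx aA //.
  move: na nA; rewrite /p big_set1 -!ltNge [in X in _ -> _ -> X](big_setD1 a aA) /=; lra.
have [|G [G1 G2 G3]] := IH (D :\: A).
  move: hD; rewrite (big_setID A) /= (finset.setIidPr AD) -[k.+1]addn1 natrD mulrDl mul1r.
  lra.
exists (fun j => if unlift ord0 j is Some i then G i else A); split.
- move=> j; case: unliftP => [i _|_ //].
  by apply: fintype.subset_trans (G1 i) (finset.subsetDl _ _).
- have dis i : [disjoint A & G i].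
    rewrite disjoint_sym; apply: disjointWl (G1 i) _.
    by rewrite -finset.setI_eq0; apply/eqP/finset.setP => x; rewrite !inE; case: (x \in A); rewrite ?andbF.
  move=> i j; case: unliftP => [i' ->|->]; case: unliftP => [j' ->|->].
  + by move=> ne; apply: G2; apply: contraNneq ne => ->.
  + by rewrite disjoint_sym.
  + by [].
  + by rewrite eqxx.
- by move=> j; case: unliftP => [i _|_].
Qed.

(** * Directions of vectors *)

Section Euclid.
Variables (R : rcfType) (I : finType).
Implicit Types a b : I -> R.

Definition nrm a : R := Num.sqrt (\sum_j a j ^+ 2).

Lemma nrm_ge0 a : 0 <= nrm a. Proof. exact: sqrtr_ge0. Qed.

Lemma nrm_sqr a : nrm a ^+ 2 = \sum_j a j ^+ 2.
Proof. by rewrite sqr_sqrtr // sumr_ge0 // => j _; apply: sqr_ge0. Qed.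

Lemma le_nrm a j : `|a j| <= nrm a.
Proof.
rewrite -(@ler_pXn2r _ 2) ?nnegrE ?normr_ge0 ?nrm_ge0 // nrm_sqr real_normK ?num_real //.
by rewrite (bigD1 j) //= lerDl sumr_ge0 // => i _; apply: sqr_ge0.
Qed.

Lemma nrm_eq0 a : nrm a = 0 -> forall j, a j = 0.
Proof. by move=> a0 j; apply/eqP; rewrite -normr_le0 -a0 le_nrm. Qed.

Lemma cauchy_nrm a b : - (nrm a * nrm b) <= \sum_j a j * b j.
Proof.
have [a0|a0] := eqVneq (nrm a) 0.
  by rewrite a0 mul0r oppr0 big1 // => j _; rewrite nrm_eq0 ?mul0r.
have [b0|b0] := eqVneq (nrm b) 0.
  by rewrite b0 mulr0 oppr0 big1 // => j _; rewrite (nrm_eq0 b0) ?mulr0.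
have pa : 0 < nrm a by rewrite lt_def a0 nrm_ge0.
have pb : 0 < nrm b by rewrite lt_def b0 nrm_ge0.
have : 0 <= \sum_j (nrm b * a j + nrm a * b j) ^+ 2.
  by rewrite sumr_ge0 // => j _; apply: sqr_ge0.
have -> : \sum_j (nrm b * a j + nrm a * b j) ^+ 2 =
   nrm b ^+ 2 * \sum_j a j ^+ 2 + nrm a ^+ 2 * \sum_j b j ^+ 2
   + 2 * (nrm a * nrm b) * \sum_j a j * b j.
  rewrite !mulr_sumr -!big_split /=; apply: eq_bigr => j _; ring.
rewrite -!nrm_sqr.
have -> : nrm b ^+ 2 * nrm a ^+ 2 + nrm a ^+ 2 * nrm b ^+ 2 +
  2 * (nrm a * nrm b) * (\sum_j a j * b j) =
  2 * (nrm a * nrm b) * (nrm a * nrm b + \sum_j a j * b j) by ring.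
by rewrite pmulr_rge0 ?mulr_gt0 //; lra.
Qed.

Lemma nrm_add_sqr a b : nrm (fun j => a j + b j) ^+ 2 =
  nrm a ^+ 2 + nrm b ^+ 2 + 2 * \sum_j a j * b j.
Proof.
rewrite !nrm_sqr mulr_sumr -!big_split /=; apply: eq_bigr => j _; ring.
Qed.

(** Reverse triangle inequality for [a] and [- b]: the norm of the sum is the distance from [a] to
    the antipode of [b]. *)
Lemma dist_nrm a b : `|nrm a - nrm b| <= nrm (fun j => a j + b j).
Proof.
rewrite -(@ler_pXn2r _ 2) ?nnegrE ?normr_ge0 ?nrm_ge0 // real_normK ?num_real //.
by rewrite nrm_add_sqr; have := cauchy_nrm a b; lra.
Qed.

Definition dir a (j : I) : R := a j / nrm a.

Lemma nrm_dir a j : nrm a * dir a j = a j.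
Proof.
have [a0|a0] := eqVneq (nrm a) 0; first by rewrite a0 mul0r nrm_eq0.
by rewrite mulrC divfK.
Qed.

Lemma dir_le1 a j : `|dir a j| <= 1.
Proof.
rewrite normrM normfV (ger0_norm (nrm_ge0 a)).
have [a0|a0] := eqVneq (nrm a) 0; first by rewrite a0 invr0 mulr0.
by rewrite ler_pdivrMr ?mul1r ?le_nrm // lt_def a0 nrm_ge0.
Qed.

Lemma sum_dir_sqr a : nrm a != 0 -> \sum_j dir a j ^+ 2 = 1.
Proof.
move=> a0; under eq_bigr do rewrite expr_div_n.
by rewrite -mulr_suml -nrm_sqr divff // expf_neq0.
Qed.

(** If [b] is the shorter vector, [nrm b * dir a + b] equals [(a + b) + (nrm b - nrm a) * dir a],
    and both terms are bounded by the norm of [a + b]. *)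
Lemma min_nrm_dir a b j : Num.min (nrm a) (nrm b) * `|dir a j + dir b j| <=
  2 * nrm (fun j => a j + b j).
Proof.
wlog ab : a b / nrm b <= nrm a => [H|].
  have /orP[|] := le_total (nrm b) (nrm a); first exact: H.
  have e : (fun j => b j + a j) = (fun j => a j + b j) by apply/funext => i; rewrite addrC.
  by move=> /H; rewrite minC [dir b j + _]addrC e.
rewrite min_r // -[X in X * _](ger0_norm (nrm_ge0 b)) -normrM mulrDr nrm_dir.
have -> : nrm b * dir a j + b j = (a j + b j) + (nrm b - nrm a) * dir a j.
  by rewrite mulrBl nrm_dir; ring.
apply: le_trans (ler_normD _ _) _; rewrite normrM mulr_natl mulr2n.
apply: lerD; first exact: (le_nrm (fun j => a j + b j)).
apply: le_trans (dist_nrm a b); rewrite distrC ler_piMr ?normr_ge0 ?dir_le1 //.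
Qed.
End Euclid.

(** * Choosing a good shift by averaging *)

Lemma exists_le_avg (R : realFieldType) (m : nat) (f : 'I_m -> R) (c : R) :
  (0 < m)%N -> \sum_i f i <= m%:R * c -> exists i, f i <= c.
Proof.
move=> m0 h; apply: contrapT => H.
have {}H i : c < f i by rewrite ltNge; apply/negP => h'; apply: H; exists i.
suff : m%:R * c < \sum_i f i by rewrite ltNge h.
have <- : \sum_(i < m) c = m%:R * c by rewrite sumr_const card_ord mulr_natl.
apply: ltr_sum => //; apply/hasP; exists (Ordinal m0) => //.
Qed.

(** The random shift is uniform on the multiples of [1/m]; some shift does at least as well as the
    average given by [count_quantize_neq]. *)
Lemma quantizer_cut (R : realType) (V : finType) (W : V -> V -> R) (t : V -> R)
    (e : R) : (forall x y, 0 <= W x y) -> 0 < e ->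
  exists a : R, 0 <= a < 1 /\
    \sum_x \sum_y W x y * (quantize a (t y) != - quantize a (t x))%:R
    <= \sum_x \sum_y W x y * `|t x + t y| + e.
Proof.
move=> W0 e0; pose w := \sum_x \sum_y W x y.
have w0 : 0 <= w by rewrite sumr_ge0 // => x _; rewrite sumr_ge0.
(* The constant 2 of the count, averaged over [m] shifts, costs [2 * w / m], which this choice
   brings below [e]. *)
pose m := (Num.truncn (2 * w / e)).+1.
have m0 : 0 < m%:R :> R by rewrite ltr0n.
have hm : 2 * w <= m%:R * e.
  rewrite -ler_pdivrMr //; have /truncn_itv/andP[_ /ltW //] : 0 <= 2 * w / e.
  by rewrite divr_ge0 ?mulr_ge0 // ltW.
pose f (i : 'I_m) := \sum_x \sum_y
  W x y * (quantize (i%:R / m%:R) (t y) != - quantize (i%:R / m%:R) (t x))%:R.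
have im (i : 'I_m) : 0 <= (i%:R / m%:R : R) < 1.
  by rewrite divr_ge0 //= ltr_pdivrMr // mul1r ltr_nat.
have [||i fi] := @exists_le_avg _ m f (\sum_x \sum_y W x y * `|t x + t y| + e).
- by [].
- rewrite /f exchange_big /=.
  under eq_bigr do rewrite exchange_big /=.
  apply: (@le_trans _ _ (\sum_x \sum_y W x y * (m%:R * `|t x + t y| + 2))).
    apply: ler_sum => x _; apply: ler_sum => y _; rewrite -mulr_sumr ler_wpM2l //.
    have -> : t x + t y = t y - - t x by ring.
    apply: le_trans (count_quantize_neq (t y) (- t x) _) => //.
    by apply: ler_sum => i _; rewrite quantizeN.
  rewrite mulrDr; apply: le_trans (lerD (lexx _) hm).
  rewrite /w !mulr_sumr -big_split /=; apply: ler_sum => x _.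
  rewrite !mulr_sumr -big_split /=; apply: ler_sum => y _.
  by rewrite mulrDr [W x y * 2]mulrC mulrCA.
by exists (i%:R / m%:R).
Qed.

(** * The dual Cheeger inequality on a finite graph *)

Section AntipodalLabels.
Variables (V : finType) (Z : zmodType) (lab : V -> Z).

Definition antipodal x y := lab y == - lab x.

Definition same_class x y := (lab y == lab x) || (lab y == - lab x).

(** [pick] depends only on the class as a predicate, so antipodal points get the same
    representative. The default is never reached, as [x] lies in its own class. *)
Definition class_rep x := odflt x [pick y | same_class x y].

Lemma class_repP x : same_class x (class_rep x).
Proof.
by rewrite /class_rep; case: pickP => //= /(_ x); rewrite /same_class eqxx.
Qed.

Lemma class_rep_antipodal x y : antipodal x y -> class_rep x = class_rep y.
Proof.
move=> /eqP e; rewrite /class_rep.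
have -> : [pick z | same_class y z] = [pick z | same_class x z].
  by apply: eq_pick => z; rewrite /same_class e opprK orbC.
by case: pickP => //= /(_ x); rewrite /same_class eqxx.
Qed.

(** Orients each pair of opposite labels by declaring positive the label of the class
    representative. *)
Definition positive_end x := lab x == lab (class_rep x).

Lemma positive_end_antipodal x y : lab x != - lab x -> antipodal x y ->
  positive_end y = ~~ positive_end x.
Proof.
move=> nx xy; rewrite /positive_end -(class_rep_antipodal xy).
move/eqP: xy => ->; have /orP[] := class_repP x => /eqP ->.
  by rewrite eqxx eq_sym (negPf nx).
by rewrite eqxx (negPf nx).
Qed.
End AntipodalLabels.

(** * Cells, groups and level sets in a weighted finite graph *)

Section FiniteGraph.
Variables (R : realType) (V : finType) (k : nat).
Variables (w : V -> V -> R) (F : V -> 'I_k -> R) (lam : R).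
Hypothesis k0 : (0 < k)%N.
Hypothesis w0 : forall x y, 0 <= w x y.
Hypothesis wC : forall x y, w x y = w y x.
Let mu x := \sum_y w x y.
Hypothesis isotropic : forall v : 'I_k -> R,
  \sum_x mu x * (\sum_j v j * F x j) ^+ 2 <= (1 + (8 * k%:R)^-1) * \sum_j v j ^+ 2.
Hypothesis total_mass : k%:R - 1 / 8 <= \sum_x mu x * nrm (F x) ^+ 2.
Hypothesis lam0 : 0 < lam.
Hypothesis energy :
  \sum_x \sum_y w x y * nrm (fun j => F x j + F y j) ^+ 2 <= 2 * k%:R * lam.

Let b := Num.sqrt lam.
Let b0 : 0 < b. Proof. by rewrite sqrtr_gt0. Qed.
Let b2 : lam = b ^+ 2. Proof. by rewrite sqr_sqrtr // ltW. Qed.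
Let s : R := (8 * k%:R)^-1.
Let kR : 1 <= k%:R :> R. Proof. by rewrite ler1n. Qed.
Let s0 : 0 < s. Proof. by rewrite invr_gt0 mulr_gt0 ?ltr0n. Qed.
Let sk : 8 * k%:R * s = 1.
Proof. by rewrite mulfV // mulf_neq0 // pnatr_eq0 -lt0n. Qed.
Let m x y := Num.min (nrm (F x)) (nrm (F y)).
Let N x y := nrm (fun j => F x j + F y j).
Let n x := nrm (F x).

Let mu0 x : 0 <= mu x. Proof. exact: sumr_ge0. Qed.

Let wm0 x y : 0 <= w x y * m x y ^+ 2.
Proof. by rewrite mulr_ge0 ?sqr_ge0. Qed.

(** Isotropy at each of the [k] coordinate vectors gives [k * (1 + s) <= 2 * k]. *)
Let mass_le : \sum_x mu x * n x ^+ 2 <= 2 * k%:R.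
Proof.
apply: (@le_trans _ _ (\sum_(i < k) (1 + s))); last first.
  rewrite sumr_const card_ord; have := sk; have := kR; have := s0.
  have -> : (1 + s) *+ k = k%:R + k%:R * s by rewrite -mulr_natl mulrDr mulr1.
  by lra.
under eq_bigr do rewrite nrm_sqr mulr_sumr.
rewrite exchange_big /=; apply: ler_sum => j _.
have := isotropic (fun i => (i == j)%:R).
have -> : \sum_i (i == j)%:R ^+ 2 = 1 :> R.
  rewrite (bigD1 j) //= eqxx expr1n big1 ?addr0 // => i /negPf ->.
  by rewrite expr0n.
rewrite mulr1; apply: le_trans; rewrite le_eqVlt; apply/orP; left; apply/eqP.
apply: eq_bigr => x _; congr (_ * _ ^+ 2).
rewrite (bigD1 j) //= eqxx mul1r big1 ?addr0 // => i /negPf ->.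
by rewrite mul0r.
Qed.

Let double_mass : \sum_x \sum_y w x y * (n x ^+ 2 + n y ^+ 2) =
  2 * \sum_x mu x * n x ^+ 2.
Proof.
under eq_bigr do under eq_bigr do rewrite mulrDr.
under eq_bigr do rewrite big_split /=.
rewrite big_split /= mulr_natl mulr2n; congr (_ + _).
  by apply: eq_bigr => x _; rewrite mulr_suml.
rewrite exchange_big /=; apply: eq_bigr => x _; rewrite mulr_suml.
by apply: eq_bigr => y _; rewrite wC.
Qed.

Let min_mass : \sum_x \sum_y w x y * m x y ^+ 2 <= \sum_x mu x * n x ^+ 2.
Proof.
apply: ler_sum => x _; rewrite mulr_suml; apply: ler_sum => y _.
rewrite ler_wpM2l // ler_pXn2r ?nnegrE ?nrm_ge0 // ?ge_min ?lexx //.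
by rewrite le_min !nrm_ge0.
Qed.

(* AM-GM with weight [b = sqrt lam], in place of the Cauchy-Schwarz inequality *)
Let min_energy : \sum_x \sum_y w x y * (m x y * (2 * N x y)) <= 4 * k%:R * b.
Proof.
have h x y : w x y * (m x y * (2 * N x y)) <=
    b * (w x y * m x y ^+ 2) + b^-1 * (w x y * N x y ^+ 2).
  have -> : b * (w x y * m x y ^+ 2) + b^-1 * (w x y * N x y ^+ 2) =
     w x y * (b * m x y ^+ 2 + b^-1 * N x y ^+ 2) by ring.
  rewrite ler_wpM2l //.
  have : 0 <= b^-1 * (b * m x y - N x y) ^+ 2.
    by rewrite mulr_ge0 ?sqr_ge0 // invr_ge0 ltW.
  have -> : b^-1 * (b * m x y - N x y) ^+ 2 =
    b * m x y ^+ 2 + b^-1 * N x y ^+ 2 - m x y * (2 * N x y).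
    by field; rewrite gt_eqF.
  by rewrite subr_ge0.
apply: (@le_trans _ _ (b * (2 * k%:R) + b^-1 * (2 * k%:R * lam))).
  apply: le_trans (lerD (ler_wpM2l (ltW b0) (le_trans min_mass mass_le))
    (ler_wpM2l _ energy)); last by rewrite invr_ge0 ltW.
  rewrite !mulr_sumr -big_split /=; apply: ler_sum => x _.
  by rewrite !mulr_sumr -big_split /=; apply: ler_sum => y _.
rewrite b2 le_eqVlt; apply/orP; left; apply/eqP; field; rewrite gt_eqF //.
Qed.

(** Here [n x ^+ 2 - m x y ^+ 2 <= (n x + n y) * N x y], by the reverse triangle inequality. AM-GM
    with weight [b] then yields [4 * k * b] from the mass and [k * b] from the energy. *)
Let diff_energy :
  \sum_x \sum_y w x y * (n x ^+ 2 - m x y ^+ 2) <= 5 * k%:R * b.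
Proof.
have h x y : w x y * (n x ^+ 2 - m x y ^+ 2) <=
    b * (w x y * (n x ^+ 2 + n y ^+ 2)) + b^-1 / 2 * (w x y * N x y ^+ 2).
  have -> : b * (w x y * (n x ^+ 2 + n y ^+ 2)) + b^-1 / 2 * (w x y * N x y ^+ 2) =
     w x y * (b * (n x ^+ 2 + n y ^+ 2) + b^-1 / 2 * N x y ^+ 2) by ring.
  rewrite ler_wpM2l //.
  have : 0 <= b^-1 / 2 * (b * (n x + n y) - N x y) ^+ 2.
    by rewrite mulr_ge0 ?sqr_ge0 // divr_ge0 // invr_ge0 ltW.
  have -> : b^-1 / 2 * (b * (n x + n y) - N x y) ^+ 2 =
    b / 2 * (n x + n y) ^+ 2 + b^-1 / 2 * N x y ^+ 2 - (n x + n y) * N x y.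
    by field; rewrite gt_eqF.
  have : 0 <= b / 2 * (n x - n y) ^+ 2 by rewrite mulr_ge0 ?sqr_ge0 // divr_ge0 // ltW.
  have : n x ^+ 2 - m x y ^+ 2 <= (n x + n y) * N x y.
    have := dist_nrm (F x) (F y); rewrite -/(N x y) -/(n x) -/(n y) ler_norml.
    have := nrm_ge0 (F x); have := nrm_ge0 (F y); rewrite -/(n x) -/(n y).
    have := nrm_ge0 (fun j => F x j + F y j); rewrite -/(N x y).
    move=> Np yp xp /andP[_ h2].
    have q1 := mulr_ge0 (addr_ge0 xp yp) Np.
    have q2 : 0 <= (n x + n y) * (N x y - (n x - n y)).
      by apply: mulr_ge0; [exact: addr_ge0 | rewrite subr_ge0].
    by rewrite /m -/(n x) -/(n y); case: (lerP (n x) (n y)) => _; lra.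
  nra.
apply: (@le_trans _ _ (b * (2 * (2 * k%:R)) + b^-1 / 2 * (2 * k%:R * lam))).
  have bm : \sum_x \sum_y w x y * (n x ^+ 2 + n y ^+ 2) <= 2 * (2 * k%:R).
    by rewrite double_mass ler_wpM2l ?mass_le.
  apply: le_trans (lerD (ler_wpM2l (ltW b0) bm)
    (ler_wpM2l _ energy)); last by rewrite divr_ge0 // invr_ge0 ltW.
  rewrite !mulr_sumr -big_split /=; apply: ler_sum => x _.
  by rewrite !mulr_sumr -big_split /=; apply: ler_sum => y _.
rewrite b2 le_eqVlt; apply/orP; left; apply/eqP; field; rewrite gt_eqF //.
Qed.

(** Each coordinate receives its own shift, since cuts are counted coordinate by coordinate; the
    error allowed in the averaging is [b]. *)
Let shifts : {a : 'I_k -> R | forall j, 0 <= a j < 1 /\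
  \sum_x \sum_y w x y * m x y ^+ 2 *
     (quantize (a j) (dir (F y) j / s) != - quantize (a j) (dir (F x) j / s))%:R
  <= \sum_x \sum_y w x y * m x y ^+ 2 * `|dir (F x) j / s + dir (F y) j / s| + b}.
Proof.
apply: cid; apply: (@fin_all_exists 'I_k (fun=> R) (fun j a => 0 <= a < 1 /\
  \sum_x \sum_y w x y * m x y ^+ 2 *
     (quantize a (dir (F y) j / s) != - quantize a (dir (F x) j / s))%:R
  <= \sum_x \sum_y w x y * m x y ^+ 2 * `|dir (F x) j / s + dir (F y) j / s| + b)).
move=> j; apply: (quantizer_cut (W := fun x y => w x y * m x y ^+ 2)) => // x y.
Qed.

Let a := sval shifts.
Let a01 j : 0 <= a j < 1. Proof. by have [] := svalP shifts j. Qed.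

Let lab (x : V) : {ffun 'I_k -> int} := [ffun j => quantize (a j) (dir (F x) j / s)].

(** Union bound: labels fail to be opposite only if some coordinate does. Each coordinate costs
    [8 * k] (the inverse grid side) times the bound [4 * k * b] of [min_energy], plus [b] for the
    choice of its shift. *)
Let cut_le : \sum_x \sum_y w x y * m x y ^+ 2 * (~~ antipodal lab x y)%:R <=
  33 * k%:R ^+ 3 * b.
Proof.
pose c j x y : R := (quantize (a j) (dir (F y) j / s) != - quantize (a j) (dir (F x) j / s))%:R.
apply: (@le_trans _ _ (\sum_x \sum_y w x y * m x y ^+ 2 * \sum_j c j x y)).
  apply: ler_sum => x _; apply: ler_sum => y _; rewrite ler_wpM2l //.
  have [anti|nanti] := boolP (antipodal lab x y); first by rewrite /= sumr_ge0 // => j _; rewrite ler0n.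
  have [j cj] : exists j, quantize (a j) (dir (F y) j / s) != - quantize (a j) (dir (F x) j / s).
    apply/existsP; apply: contraR nanti; rewrite negb_exists => /forallP h.
    by apply/eqP/ffunP => j; have := h j; rewrite negbK !ffunE => /eqP.
  by rewrite (bigD1 j) //= /c cj lerDl sumr_ge0.
apply: (@le_trans _ _ (\sum_(j < k) (32 * k%:R ^+ 2 * b + b))); last first.
  rewrite sumr_const card_ord -[leLHS]mulr_natl.
  have -> : k%:R * (32 * k%:R ^+ 2 * b + b) = (32 * k%:R ^+ 3 + k%:R) * b by ring.
  have k3 : k%:R <= k%:R ^+ 3 :> R by rewrite -{1}[k%:R]expr1 ler_weXn2l.
  by rewrite ler_wpM2r ?(ltW b0) //; lra.
under eq_bigr do under eq_bigr do rewrite mulr_sumr.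
under eq_bigr do rewrite exchange_big /=.
rewrite exchange_big /=; apply: ler_sum => j _.
have [_ h] := svalP shifts j; apply: le_trans h _; rewrite lerD2r.
apply: (@le_trans _ _ (8 * k%:R * (4 * k%:R * b))); last by nra.
apply: le_trans (ler_wpM2l _ min_energy); last by rewrite mulr_ge0.
rewrite mulr_sumr; apply: ler_sum => x _; rewrite mulr_sumr; apply: ler_sum => y _.
rewrite -mulrDl normrM normfV (gtr0_norm s0) /s invrK.
have -> : w x y * m x y ^+ 2 * (`|dir (F x) j + dir (F y) j| * (8 * k%:R)) =
  8 * k%:R * (w x y * (m x y * (m x y * `|dir (F x) j + dir (F y) j|))) by ring.
rewrite ler_wpM2l ?mulr_ge0 // ler_wpM2l // ler_wpM2l ?le_min ?nrm_ge0 //.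
exact: min_nrm_dir.
Qed.

(** Label 0 would force every coordinate of the unit vector [dir (F x)] below [s] in absolute value,
    hence a squared norm of at most [k * s = 1 / 8]. *)
Let lab_neq0 x : 0 < n x -> lab x != 0.
Proof.
move=> nx; apply/eqP => l0.
have h j : dir (F x) j ^+ 2 <= s.
  have /(congr1 (fun f : {ffun _} => f j)) := l0; rewrite !ffunE => /quantize_eq0.
  have /andP[aj _] := a01 j => /(_ aj).
  rewrite normrM normfV (gtr0_norm s0) ltr_pdivrMr // mul1r => h.
  rewrite -real_normK ?num_real // expr2.
  have := dir_le1 (F x) j; have := normr_ge0 (dir (F x) j); nra.
have : \sum_(j < k) dir (F x) j ^+ 2 <= \sum_(j < k) s by apply: ler_sum.
rewrite sum_dir_sqr ?gt_eqF // sumr_const card_ord -[X in _ <= X -> _]mulr_natl.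
by have := sk; lra.
Qed.

Let lab_neqN x : 0 < n x -> lab x != - lab x.
Proof.
move=> /lab_neq0; apply: contraNneq => e.
apply/eqP/ffunP => j; move: (congr1 (fun f : {ffun _} => f j) e); rewrite !ffunE.
by move=> /eqP; rewrite -subr_eq0 opprK -mulr2n mulrn_eq0 => /eqP.
Qed.

(** Directions in the class lie within [2 * s] of [v] or of [- v] in every coordinate, so their
    inner product with [v] is at least [1 - k * (2 * s) ^ 2 / 2 = r] in absolute value. Isotropy at
    [v] bounds the mass by [(1 + s) / r ^ 2]. *)
Let class_mass x0 : 0 < n x0 ->
  \sum_(x | same_class lab x0 x) mu x * n x ^+ 2 <= 1 + 2 * s.
Proof.
move=> nx0; pose v := dir (F x0).
pose r := 1 - s / 4.
have s1 : s <= 1 / 8 by have := sk; have := kR; nra.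
have r0 : 0 < r by rewrite /r; lra.
rewrite -(ler_pM2l (exprn_gt0 2 r0)).
apply: (@le_trans _ _ (1 + s)); last by rewrite /r; have := s0; nra.
have := isotropic v; rewrite sum_dir_sqr ?gt_eqF // mulr1; apply: le_trans.
rewrite mulr_sumr big_mkcond /=; apply: ler_sum => x _.
case: ifP => sc; last by rewrite mulr_ge0 ?sqr_ge0.
rewrite mulrCA ler_wpM2l // -exprMn.
have [nx|nx] := eqVneq (n x) 0.
  by rewrite nx mulr0 expr0n sqr_ge0.
have nx' : 0 < n x by rewrite lt_def nx nrm_ge0.
have key (e : R) : e ^+ 2 = 1 -> (forall j, `|dir (F x) j - e * v j| <= 2 * s) ->
    r <= e * \sum_j v j * dir (F x) j.
  move=> e1 close.
  have : \sum_j (dir (F x) j - e * v j) ^+ 2 <= \sum_(j < k) (2 * s) ^+ 2.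
    apply: ler_sum => j _; rewrite -[leLHS]real_normK ?num_real //.
    by rewrite ler_pXn2r ?nnegrE ?normr_ge0 // mulr_ge0 // ltW.
  rewrite sumr_const card_ord -[X in _ <= X -> _]mulr_natl.
  have -> : \sum_j (dir (F x) j - e * v j) ^+ 2 =
      \sum_j dir (F x) j ^+ 2 + \sum_j v j ^+ 2 - 2 * (e * \sum_j v j * dir (F x) j).
    rewrite !mulr_sumr -big_split -sumrB /=; apply: eq_bigr => j _.
    have -> : v j ^+ 2 = e ^+ 2 * v j ^+ 2 by rewrite e1 mul1r.
    by ring.
  rewrite !sum_dir_sqr ?gt_eqF //.
  have -> : k%:R * (2 * s) ^+ 2 = 8 * k%:R * s * (s / 2) by field.
  by rewrite sk /r; lra.
have -> : \sum_j v j * F x j = n x * \sum_j v j * dir (F x) j.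
  by rewrite mulr_sumr; apply: eq_bigr => j _; rewrite mulrCA nrm_dir.
rewrite !exprMn mulrC ler_wpM2l ?sqr_ge0 //.
have [e [e1 /key re]] : exists e : R, e ^+ 2 = 1 /\ (forall j, `|dir (F x) j - e * v j| <= 2 * s).
  have conv (t t' : R) : `|t / s - t' / s| < 2 -> `|t - t'| <= 2 * s.
    by rewrite -mulrBl normrM normfV (gtr0_norm s0) ltr_pdivrMr // => /ltW.
  have aj j : 0 <= a j by have /andP[] := a01 j.
  case/orP: sc => /eqP l; [exists 1|exists (-1)]; rewrite ?sqrrN expr1n; split=> // j;
    have := congr1 (fun f : {ffun _} => f j) l; rewrite !ffunE.
    by move=> /(quantize_close (aj j))/conv; rewrite mul1r.
  by rewrite -quantizeN // -mulNr => /(quantize_close (aj j))/conv; rewrite mulN1r.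
have -> : (\sum_j v j * dir (F x) j) ^+ 2 = (e * \sum_j v j * dir (F x) j) ^+ 2.
  by rewrite exprMn e1 mul1r.
have := re e1; nra.
Qed.

Let rep := class_rep lab.
Let mass (c : V) := \sum_(x | rep x == c) mu x * n x ^+ 2.

(** A fibre of [rep] lies inside the class of any of its points. If one of them has positive norm,
    [class_mass] applies there; otherwise the mass is 0. *)
Let mass_bound c : 0 <= mass c <= 1 + 2 * s.
Proof.
have pos x : 0 <= mu x * n x ^+ 2 by rewrite mulr_ge0 ?sqr_ge0.
rewrite /mass sumr_ge0 //=.
have [/existsP[x /andP[/eqP rx nx]]|] := boolP [exists x, (rep x == c) && (0 < n x)].
  apply: le_trans (class_mass nx); rewrite [leRHS](bigID (fun y => rep y == c)) /=.
  rewrite -[leLHS]addr0 lerD ?sumr_ge0 // le_eqVlt; apply/orP; left; apply/eqP.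
  apply: eq_bigl => y; rewrite andbC; case: eqP => //= ry; apply/esym.
  have := class_repP lab x; have := class_repP lab y; rewrite -/rep ry rx.
  rewrite /same_class => /orP[]/eqP e1 /orP[]/eqP e2.
  - by rewrite -e1 e2 eqxx.
  - by rewrite -e1 e2 eqxx orbT.
  - by rewrite -[lab y]opprK -e1 e2 eqxx orbT.
  - by rewrite -[lab y]opprK -e1 e2 opprK eqxx.
rewrite negb_exists => /forallP h; rewrite big1; first by have := s0; lra.
move=> x rx; have := h x; rewrite rx /= lt_def nrm_ge0 andbT negbK => /eqP ->.
by rewrite expr0n mulr0.
Qed.

(** The sets [S i] are level sets inside disjoint groups of classes, and [pos] splits each of them
    into antipodal halves. The layer-cake functional weighs antipodal edges against [1 - K] times
    the measure. *)
Lemma finite_dual_cheeger : exists (S : 'I_k -> {set V}) (pos : pred V),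
  (forall i j, i != j -> [disjoint S i & S j]) /\
  forall i, 0 < \sum_(x in S i) \sum_y w x y /\
    (1 - 77 * k%:R ^+ 3 * Num.sqrt lam) * \sum_(x in S i) \sum_y w x y <=
    2 * \sum_(x in S i | pos x) \sum_(y in S i | ~~ pos y) w x y.
Proof.
have s2 : 1 <= 1 + 2 * s by have := s0; lra.
have [|G [_ Gdis Gmass]] := greedy_grouping s2 mass_bound (k := k) (D := [set: V]).
  have <- : \sum_x mu x * n x ^+ 2 = \sum_(c in [set: V]) mass c.
    rewrite (partition_big rep xpredT) //=; apply: eq_big => // c.
    by rewrite inE.
  (* As [k * s = 1 / 8], the grouping condition reads [k + 3 / 4 <= k + 7 / 8 + 2 * s]. *)
  apply: le_trans (lerD total_mass (lexx _)); have := sk; have := s0; lra.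
pose g i x := if rep x \in G i then n x ^+ 2 else 0.
(* [diff_energy] and [cut_le] bound the total boundary by [38 * k ^ 3 * b], and
   each group has mass at least [1 / 2]. *)
pose K := 77 * k%:R ^+ 3 * b.
have K0 : 0 < K by rewrite !mulr_gt0 ?exprn_gt0 ?ltr0n.
have k3 : k%:R <= k%:R ^+ 3 :> R by rewrite -{1}[k%:R]expr1 ler_weXn2l.
have step i : exists S : {set V}, (forall x, x \in S -> 0 < g i x) /\
    0 < \sum_(x in S) (K - 1) * mu x +
        \sum_(x in S) \sum_(y in S) w x y * (antipodal lab x y)%:R.
  apply: layer_cake => [x|]; first by rewrite /g; case: ifP; rewrite ?sqr_ge0.
  have gm : 1 / 2 <= \sum_x mu x * g i x.
    apply: le_trans (Gmass i) _.
    rewrite /mass (exchange_big_dep xpredT) //= le_eqVlt; apply/orP; left; apply/eqP.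
    apply: eq_bigr => x _; rewrite /g; case: ifPn => rx.
      rewrite (big_pred1 (rep x)) // => c /=; rewrite eq_sym.
      by case: eqP => [->|]; rewrite ?rx ?andbF.
    rewrite mulr0 big_pred0 // => c; apply/negP => /andP[cG /eqP e].
    by move: rx; rewrite e cG.
  have Kgm : K / 2 <= K * \sum_x mu x * g i x.
    have -> : K / 2 = K * (1 / 2) by field.
    by rewrite ler_wpM2l ?(ltW K0).
  (* Antipodal points share a representative, hence a group, and lose at most
     [n x ^+ 2 - m x y ^+ 2]; any other edge loses at most [n x ^+ 2], which exceeds this by the
     term counted in [cut_le]. *)
  have bad : \sum_x \sum_y w x y *
      (g i x - (antipodal lab x y)%:R * Num.min (g i x) (g i y)) <=
      (5 * k%:R + 33 * k%:R ^+ 3) * b.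
    rewrite mulrDl; apply: le_trans (lerD diff_energy cut_le).
    rewrite -big_split /=; apply: ler_sum => x _.
    rewrite -big_split /=; apply: ler_sum => y _.
    rewrite -mulrA -mulrDr ler_wpM2l //.
    have mE : Num.min (n x ^+ 2) (n y ^+ 2) = m x y ^+ 2.
      have nn z : n z \in Num.nneg by rewrite nnegrE nrm_ge0.
      rewrite /m -/(n x) -/(n y); case: (leP (n x) (n y)) => h.
        by rewrite min_l // ler_pXn2r.
      by rewrite min_r // ler_pXn2r // ltW.
    have mx : m x y ^+ 2 <= n x ^+ 2 by rewrite -mE ge_min lexx.
    have m0 := sqr_ge0 (m x y).
    have [anti|_] := boolP (antipodal lab x y); rewrite /=.
      have e : rep y = rep x by rewrite /rep -(class_rep_antipodal anti).
      by rewrite /g e; case: ifP => _; rewrite ?mE ?minxx; lra.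
    by rewrite /g; case: ifP => _; lra.
  move: bad => /=.
  have -> : \sum_x \sum_y w x y *
      (g i x - (antipodal lab x y)%:R * Num.min (g i x) (g i y)) =
    \sum_x mu x * g i x -
    \sum_x \sum_y w x y * (antipodal lab x y)%:R * Num.min (g i x) (g i y).
    rewrite -sumrB; apply: eq_bigr => x _; rewrite mulr_suml -sumrB.
    by apply: eq_bigr => y _; rewrite mulrBr mulrA.
  have -> : \sum_x (K - 1) * mu x * g i x = K * \sum_x mu x * g i x - \sum_x mu x * g i x.
    rewrite mulr_sumr -sumrB; apply: eq_bigr => x _; ring.
  have : (5 * k%:R + 33 * k%:R ^+ 3) * b < K / 2.
    rewrite /K; have -> : 77 * k%:R ^+ 3 * b / 2 = 77 / 2 * k%:R ^+ 3 * b by field.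
    by rewrite ltr_pM2r //; have := kR; lra.
  lra.
have [S HS] := @fin_all_exists _ (fun=> {set V}) _ step.
exists S, (positive_end lab); split.
  move=> i j ij; rewrite -finset.setI_eq0; apply/eqP/finset.setP => x; rewrite !inE.
  apply/negP => /andP[/(proj1 (HS i)) xi /(proj1 (HS j))].
  move: xi; rewrite /g; case: ifP => [ri _|]; rewrite ?ltxx //.
  case: ifP => [rj _|]; rewrite ?ltxx //.
  by have := Gdis _ _ ij; rewrite disjoint_subset => /fintype.subsetP/(_ _ ri); rewrite inE rj.
move=> i; have [Sg] := HS i; rewrite -mulr_sumr.
set M := \sum_(x in S i) mu x; set B := \sum_(x in S i) _ => MB.
have nS x : x \in S i -> 0 < n x.
  move=> /Sg; rewrite /g; case: ifP; rewrite ?ltxx // => _.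
  by rewrite lt_def => /andP[n2 _]; rewrite lt_def nrm_ge0 andbT; apply: contraNneq n2 => ->; rewrite expr0n.
have BM : B <= M.
  apply: ler_sum => x _; rewrite [leRHS](bigID (mem (S i))) /= -[leLHS]addr0.
  rewrite lerD ?sumr_ge0 //; apply: ler_sum => y _.
  by rewrite ler_piMr // lern1 leq_b1.
have M0 : 0 < M by rewrite -(pmulr_rgt0 _ K0); lra.
split=> //; apply: (@le_trans _ _ B); first by rewrite -/b -/K; lra.
pose q x := positive_end lab x.
pose X := \sum_(x in S i | q x) \sum_(y in S i | ~~ q y) w x y.
have -> : B <= 2 * X = (B <= X + X) by rewrite mulr_natl.
(* By symmetry the weight from the positive to the negative half equals the reverse one. [B] is then
   split by the half of its first endpoint, and antipodal edges always change halves. *)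
have {2}-> : X = \sum_(x in S i | ~~ q x) \sum_(y in S i | q y) w x y.
  rewrite /X exchange_big /=.
  by apply: eq_bigr => x _; apply: eq_bigr => y _; rewrite wC.
rewrite /B (bigID q) /=; apply: lerD; apply: ler_sum => x /andP[xS qx];
  rewrite [leRHS]big_mkcondr; apply: ler_sum => y yS;
  case: (boolP (antipodal lab x y)) => [xy|_]; rewrite ?mulr0 ?mulr1;
  try (by case: ifP).
  by rewrite /q (positive_end_antipodal (lab_neqN (nS _ xS)) xy) negbK -/(q x) qx.
by rewrite /q (positive_end_antipodal (lab_neqN (nS _ xS)) xy) -/(q x) qx.
Qed.
End FiniteGraph.

(** * Square-integrable functions *)

Local Open Scope classical_set_scope.
Local Open Scope ring_scope.

Section SquareIntegrable.
Context (d : measure_display) (T : measurableType d) (R : realType)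
  (mu : probability T R).
Implicit Types (f g h : T -> R) (A B : set T).

Lemma L2_integrable_mul f g : L2 mu f -> L2 mu g ->
  mu.-integrable setT (EFin \o (fun x => f x * g x)).
Proof.
move=> [mf f2] [mg g2].
have := integrableD measurableT f2 g2.
apply: le_integrable => //.
  by apply/measurable_EFinP; apply: measurable_funM.
move=> x _ /=; rewrite lee_fin [leRHS]ger0_norm ?addr_ge0 ?sqr_ge0 //.
rewrite ler_norml; have := sqr_ge0 (f x + g x); have := sqr_ge0 (f x - g x).
by have := sqr_ge0 (f x); have := sqr_ge0 (g x); lra.
Qed.

Lemma L2_lin a f g : L2 mu f -> L2 mu g -> L2 mu (fun x => a * f x + g x).
Proof.
move=> Lf Lg; have [mf f2] := Lf; have [mg g2] := Lg; split.
  by apply: measurable_funD => //; apply: measurable_funM.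
have mfg := L2_integrable_mul Lf Lg.
have := integrableD measurableT
  (integrableD measurableT (integrableZl measurableT (a ^+ 2) f2)
     (integrableZl measurableT (2 * a) mfg)) g2.
by apply: eq_integrable => // x _ /=; rewrite -!EFinM -!EFinD; congr EFin; ring.
Qed.

Lemma L2_cst (a : R) : L2 mu (fun=> a).
Proof.
by split; [exact: measurable_cst | exact: finite_measure_integrable_cst].
Qed.

Lemma L2_scale a f : L2 mu f -> L2 mu (fun x => a * f x).
Proof.
move=> Lf; have := L2_lin a Lf (L2_cst 0).
by congr (L2 mu _); apply/funext => x; rewrite addr0.
Qed.

Lemma L2_sub f g : L2 mu f -> L2 mu g -> L2 mu (fun x => f x - g x).
Proof.
move=> Lf Lg; have := L2_lin (-1) Lg Lf.
by congr (L2 mu _); apply/funext => x; rewrite mulN1r addrC.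
Qed.

Lemma L2_sum (I : Type) (r : seq I) (c : I -> R) (F : I -> T -> R) :
  (forall i, L2 mu (F i)) -> L2 mu (fun x => \sum_(i <- r) c i * F i x).
Proof.
move=> LF; elim: r => [|i r IH].
  by have := L2_cst 0; congr (L2 mu _); apply/funext => x; rewrite big_nil.
have := L2_lin (c i) (LF i) IH.
by congr (L2 mu _); apply/funext => x; rewrite big_cons.
Qed.

Lemma L2_indic A : measurable A -> L2 mu \1_A.
Proof.
move=> mA; split; first exact: measurable_indic.
have := integrable_indic mu mA; apply: eq_integrable => // x _.
by rewrite indicE -natrX; case: (_ \in _).
Qed.

Lemma ipC f g : ip mu f g = ip mu g f.
Proof. by rewrite /ip; congr Rintegral; apply/funext => x; rewrite mulrC. Qed.

Lemma ip_linl a f g h : L2 mu f -> L2 mu g -> L2 mu h ->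
  ip mu (fun x => a * f x + g x) h = a * ip mu f h + ip mu g h.
Proof.
move=> Lf Lg Lh; rewrite /ip.
under eq_Rintegral do rewrite mulrDl -mulrA.
rewrite RintegralD //; first by rewrite RintegralZl //; exact: L2_integrable_mul.
- have := L2_integrable_mul (L2_scale a Lf) Lh.
  by congr (integrable _ _ _); apply/funext => x /=; rewrite mulrA.
- exact: L2_integrable_mul.
Qed.

Lemma ip_linr a f g h : L2 mu f -> L2 mu g -> L2 mu h ->
  ip mu h (fun x => a * f x + g x) = a * ip mu h f + ip mu h g.
Proof. by move=> Lf Lg Lh; rewrite ipC ip_linl // ipC [ip mu g h]ipC. Qed.

Lemma ip0l h : ip mu (fun=> 0) h = 0.
Proof.
rewrite /ip; under eq_Rintegral do rewrite mul0r.
by rewrite Rintegral_cst // mul0r.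
Qed.

Lemma ip_scalel a f h : L2 mu f -> L2 mu h ->
  ip mu (fun x => a * f x) h = a * ip mu f h.
Proof.
move=> Lf Lh; rewrite -[RHS]addr0 -(ip0l h) -(ip_linl _ _ (L2_cst 0)) //.
by congr (ip mu _ _); apply/funext => x; rewrite addr0.
Qed.

Lemma ip_addl f g h : L2 mu f -> L2 mu g -> L2 mu h ->
  ip mu (fun x => f x + g x) h = ip mu f h + ip mu g h.
Proof.
move=> Lf Lg Lh; rewrite -[ip mu f h]mul1r -ip_linl //.
by congr (ip mu _ _); apply/funext => x; rewrite mul1r.
Qed.

Lemma ip_subl f g h : L2 mu f -> L2 mu g -> L2 mu h ->
  ip mu (fun x => f x - g x) h = ip mu f h - ip mu g h.
Proof.
move=> Lf Lg Lh; rewrite addrC -mulN1r -ip_linl //.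
by congr (ip mu _ _); apply/funext => x; rewrite mulN1r addrC.
Qed.

Lemma ip_suml (I : Type) (r : seq I) (c : I -> R) (F : I -> T -> R) h :
  (forall i, L2 mu (F i)) -> L2 mu h ->
  ip mu (fun x => \sum_(i <- r) c i * F i x) h = \sum_(i <- r) c i * ip mu (F i) h.
Proof.
move=> LF Lh; elim: r => [|i r IH].
  by under eq_fun do rewrite big_nil; rewrite big_nil ip0l.
under eq_fun do rewrite big_cons.
by rewrite big_cons ip_linl ?IH //; exact: L2_sum.
Qed.

Lemma ip_aeq f f' g : L2 mu f -> L2 mu f' -> L2 mu g ->
  {ae mu, forall x, f x = f' x} -> ip mu f g = ip mu f' g.
Proof.
move=> [mf _] [mf' _] [mg _] ff'; rewrite /ip /Rintegral; congr fine.
apply: ae_eq_integral => //; try by apply/measurable_EFinP; apply: measurable_funM.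
by apply: filterS ff' => x -> _.
Qed.

Lemma ip_ge0 f : 0 <= ip mu f f.
Proof. by apply: Rintegral_ge0 => x _; rewrite -expr2 sqr_ge0. Qed.

Lemma ip_pos f g : L2 mu f -> L2 mu g -> {ae mu, forall x, 0 <= f x} ->
  {ae mu, forall x, 0 <= g x} -> 0 <= ip mu f g.
Proof.
move=> [mf _] [mg _] f0 g0.
have -> : ip mu f g = Rintegral mu setT (fun x => `|f x * g x|).
  rewrite /ip /Rintegral; congr fine; apply: ae_eq_integral => //.
  - by apply/measurable_EFinP; apply: measurable_funM.
  - by apply/measurable_EFinP; apply: measurableT_comp => //; apply: measurable_funM.
  - by apply: filterS2 f0 g0 => x fx gx _; rewrite ger0_norm // mulr_ge0.
by apply: Rintegral_ge0.
Qed.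

Lemma ip_eq0 f : L2 mu f -> ip mu f f = 0 -> {ae mu, forall x, f x = 0}.
Proof.
move=> Lf f0; have [mf _] := Lf; have Iff := L2_integrable_mul Lf Lf.
have m2 : measurable_fun setT (EFin \o (fun x => f x * f x)).
  by apply/measurable_EFinP; apply: measurable_funM.
have : (\int[mu]_x `|(f x * f x)%:E| = 0)%E.
  have : (\int[mu]_x (f x * f x)%:E = 0)%E.
    by rewrite -[LHS]fineK; [rewrite -[fine _]/(ip mu f f) f0 | exact: integrable_fin_num].
  move=> <-; apply: eq_integral => x _; rewrite gee0_abs // lee_fin.
  by rewrite -expr2 sqr_ge0.
move/(ae_eq_integral_abs mu measurableT m2); apply: filterS => x /(_ I) /= [] /eqP.
by rewrite mulf_eq0 orbb => /eqP.
Qed.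

Lemma ip_indic A B : measurable A -> measurable B ->
  ip mu \1_A \1_B = fine (mu (A `&` B)).
Proof.
move=> mA mB; rewrite /ip /Rintegral; congr fine.
rewrite -[in RHS](setIT (A `&` B)) -integral_indic //; last exact: measurableI.
by apply: eq_integral => x _; rewrite /= indicI.
Qed.

(** Weighted AM-GM, read off the nonnegative square of [g - t * f]; with a free [t] it serves where
    Cauchy-Schwarz would be used. *)
Lemma ip_young (t : R) f g : 0 < t -> L2 mu f -> L2 mu g ->
  2 * ip mu f g <= t * ip mu f f + t^-1 * ip mu g g.
Proof.
move=> t0 Lf Lg; have Lh := L2_lin (- t) Lf Lg.
have : 0 <= t^-1 * ip mu (fun x => - t * f x + g x) (fun x => - t * f x + g x).
  by rewrite mulr_ge0 ?ip_ge0 // invr_ge0 ltW.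
rewrite ip_linl // !ip_linr // (ipC g f).
set a := ip mu f f; set b := ip mu f g; set c := ip mu g g.
have -> : t^-1 * (- t * (- t * a + b) + (- t * b + c)) = t * a + t^-1 * c - 2 * b.
  by field; rewrite gt_eqF.
by rewrite subr_ge0.
Qed.

Lemma ip_young_abs (t : R) f g : 0 < t -> L2 mu f -> L2 mu g ->
  2 * `|ip mu f g| <= t * ip mu f f + t^-1 * ip mu g g.
Proof.
move=> t0 Lf Lg; have h1 := ip_young t0 Lf Lg.
have := ip_young t0 (L2_scale (-1) Lf) Lg.
rewrite !ip_scalel //; last exact: L2_scale.
rewrite (ipC f (fun x => -1 * f x)) ip_scalel //.
by have [?|?] := ger0P (ip mu f g); lra.
Qed.

End SquareIntegrable.

(** * Simple functions *)

Section FiniteCoding.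
Context (d : measure_display) (T : measurableType d) (R : realType)
  (mu : probability T R).
Variables (V : finType) (c : T -> V).
Hypothesis mc : forall v, measurable (c @^-1` [set v]).
Implicit Types (phi psi : V -> R) (U : {set V}).

Local Notation fib v := (\1_(c @^-1` [set v]) : T -> R).

Lemma coding_sum phi x : phi (c x) = \sum_v phi v * fib v x.
Proof.
rewrite (bigD1 (c x)) //= big1 ?addr0.
  by rewrite indicE mem_set // mulr1.
move=> v vc; rewrite indicE memNset ?mulr0 //= => e.
by rewrite e eqxx in vc.
Qed.

Lemma coding_sumE phi : (fun x => phi (c x)) = (fun x => \sum_v phi v * fib v x).
Proof. by apply/funext => x; apply: coding_sum. Qed.

Lemma L2_fib v : L2 mu (fib v). Proof. exact: L2_indic. Qed.

Lemma L2_coding phi : L2 mu (fun x => phi (c x)).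
Proof. by rewrite coding_sumE; apply: L2_sum => v; apply: L2_fib. Qed.

Lemma measurable_coding U : measurable (c @^-1` [set` U]).
Proof.
have -> : c @^-1` [set` U] = \bigcup_(v in [set` U]) c @^-1` [set v].
  apply/seteqP; split => [x /= xU|x [v /= vU cv]]; first by exists (c x).
  by rewrite /= cv.
by apply: fin_bigcup_measurable => // v _; apply: mc.
Qed.

Lemma indic_coding U x : \1_(c @^-1` [set` U]) x = (c x \in U)%:R :> R.
Proof.
rewrite indicE; congr (nat_of_bool _)%:R.
by apply/idP/idP; rewrite inE.
Qed.
End FiniteCoding.

Lemma finite_range_coding (d : measure_display) (T : measurableType d)
    (R : realType) (g : T -> R) : measurable_fun setT g -> finite_set (range g) ->
  exists (V : finType) (c : T -> V) (phi : V -> R),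
    (forall v, measurable (c @^-1` [set v])) /\ forall x, g x = phi (c x).
Proof.
move=> mg /finite_seqP[s rs].
have gs x : g x \in s by have : range g (g x) by [exists x]; rewrite rs.
(* The extra element makes the index type nonempty, as [inord] requires. *)
exists 'I_(size s).+1, (fun x => inord (index (g x) s)), (fun v : 'I_(size s).+1 => nth 0 s v).
split=> [v|x]; last first.
  by rewrite inordK ?nth_index // ltnS index_size.
have -> : (fun x => inord (index (g x) s)) @^-1` [set v] =
  \bigcup_(r in [set r | (r \in s) && (inord (index r s) == v)]) (g @^-1` [set r]).
  apply/seteqP; split => [x /= xv|x [r /= /andP[_ /eqP rv] gr]].
    by exists (g x) => //=; rewrite gs xv eqxx.
  by rewrite /= gr.
apply: fin_bigcup_measurable => [|r _].
  by apply: (sub_finite_set _ (finite_seq s)) => r /= /andP[].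
by rewrite -[X in measurable X]setTI; apply: mg.
Qed.

Section SimpleApproximation.
Import HBSimple HBNNSimple.
Context (d : measure_display) (T : measurableType d) (R : realType)
  (mu : probability T R).

(** Positive and negative parts are approximated from below by simple functions, and dominated
    convergence gives the limit in mean square. The coding records the pair of values taken. *)
Lemma simple_approx (f : T -> R) (e : R) : L2 mu f -> 0 < e ->
  exists (V : finType) (c : T -> V) (phi : V -> R),
    (forall v, measurable (c @^-1` [set v])) /\
    ip mu (fun x => f x - phi (c x)) (fun x => f x - phi (c x)) <= e.
Proof.
move=> [mf f2] e0.
have mfp : measurable_fun setT (EFin \o (fun x => Num.max (f x) 0)).
  by apply/measurable_EFinP; apply: measurable_maxr.
have mfn : measurable_fun setT (EFin \o (fun x => Num.max (- f x) 0)).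
  by apply/measurable_EFinP; apply: measurable_maxr => //; apply: measurableT_comp.
have fp0 (x : T) : setT x -> (0 <= (Num.max (f x) 0)%:E)%E.
  by rewrite /= lee_fin le_max lexx orbT.
have fn0 (x : T) : setT x -> (0 <= (Num.max (- f x) 0)%:E)%E.
  by rewrite /= lee_fin le_max lexx orbT.
pose p n := nnsfun_approx measurableT mfp n.
pose q n := nnsfun_approx measurableT mfn n.
have p01 n x : 0 <= p n x <= Num.max (f x) 0.
  by rewrite fun_ge0 -lee_fin /p nnsfun_approxE le_approx.
have q01 n x : 0 <= q n x <= Num.max (- f x) 0.
  by rewrite fun_ge0 -lee_fin /q nnsfun_approxE le_approx.
pose r n x := f x - (p n x - q n x).
have pq x : f x = Num.max (f x) 0 - Num.max (- f x) 0.
  by rewrite /Num.max oppr_lt0; case: ltgtP => //; lra.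
(* At each point one of the two parts vanishes along with its approximation, and the other
   approximation lies between 0 and [|f x|]; hence the dominating function [f ^ 2]. *)
have r2 n x : r n x ^+ 2 <= f x ^+ 2.
  have [f0|f0] := lerP 0 (f x); have := p01 n x; have := q01 n x; rewrite /r.
    have -> : Num.max (f x) 0 = f x by rewrite max_l.
    have -> : Num.max (- f x) 0 = 0 by rewrite max_r ?oppr_le0.
    by move=> /andP[? ?] /andP[? ?]; nra.
  have -> : Num.max (f x) 0 = 0 by rewrite max_r // ltW.
  have -> : Num.max (- f x) 0 = - f x by rewrite max_l // oppr_ge0 ltW.
  by move=> /andP[? ?] /andP[? ?]; nra.
have mr n : measurable_fun setT (r n).
  by apply: measurable_funB => //; apply: measurable_funB.
have rcvg x : (r n x ^+ 2)%:E @[n --> \oo] --> (0 : R)%:E.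
  have h1 : p n x @[n --> \oo] --> Num.max (f x) 0.
    rewrite /p; under eq_fun do rewrite nnsfun_approxE.
    by apply: (cvg_approx fp0) => //=; rewrite ltry.
  have h2 : q n x @[n --> \oo] --> Num.max (- f x) 0.
    rewrite /q; under eq_fun do rewrite nnsfun_approxE.
    by apply: (cvg_approx fn0) => //=; rewrite ltry.
  apply/fine_cvgP; split; first by near=> n.
  have : r n x @[n --> \oo] --> f x - (Num.max (f x) 0 - Num.max (- f x) 0).
    by apply: cvgB; [exact: cvg_cst | exact: cvgB].
  rewrite -pq subrr => h.
  rewrite (_ : _ \o _ = (fun n => r n x) \* (fun n => r n x)); last first.
    by apply/funext => n /=; rewrite expr2.
  by rewrite -[X in _ --> X](mulr0 0); exact: cvgM.
have := @dominated_convergence _ _ _ mu _ measurableT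
  (fun n x => (r n x ^+ 2)%:E) (cst 0%E) (fun x => (f x ^+ 2)%:E).
case=> [n|||||_ _].
- by apply/measurable_EFinP; apply: measurable_funX.
- exact: measurable_cst.
- by apply: nearW => x _; apply: rcvg.
- by [].
- apply: nearW => x n _ /=.
  by rewrite lee_fin ger0_norm ?sqr_ge0.
rewrite integral0 => /fine_cvgP[_ /cvgrPdist_le/(_ _ e0)[N _ /(_ N (leqnn _))]] /=.
rewrite sub0r normrN => hN.
have [V1 [c1 [f1 [m1 e1]]]] := finite_range_coding (measurable_funPT (p N)) (fimfunP (p N)).
have [V2 [c2 [f2' [m2 e2]]]] := finite_range_coding (measurable_funPT (q N)) (fimfunP (q N)).
exists (V1 * V2)%type, (fun x => (c1 x, c2 x)), (fun v => f1 v.1 - f2' v.2); split.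
  move=> [u v]; rewrite (_ : _ @^-1` _ = c1 @^-1` [set u] `&` c2 @^-1` [set v]).
    exact: measurableI.
  by apply/seteqP; split => x /= [-> ->].
apply: le_trans (le_trans (ler_norm _) hN); rewrite le_eqVlt; apply/orP; left; apply/eqP.
rewrite /ip /Rintegral; congr fine; apply: eq_integral => x _ /=.
by rewrite -e1 -e2 -expr2.
Unshelve. all: by end_near. Qed.
End SimpleApproximation.

(** * The bilinear form of a reversible Markov operator *)

Section MarkovForm.
Context (d : measure_display) (T : measurableType d) (R : realType)
  (mu : probability T R) (P : (T -> R) -> (T -> R)).
Hypothesis PM : markov_operator mu P.
Hypothesis PR : reversible mu P.
Implicit Types f g h : T -> R.

Lemma markov_L2 f : L2 mu f -> L2 mu (P f).
Proof. by case: PM => -[h _ _] _ _; apply: h. Qed.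

Lemma ipP_lin a f g h : L2 mu f -> L2 mu g -> L2 mu h ->
  ip mu h (P (fun x => a * f x + g x)) = a * ip mu h (P f) + ip mu h (P g).
Proof.
move=> Lf Lg Lh; have [[_ _ Plin] _ _] := PM.
have LPf := markov_L2 Lf; have LPg := markov_L2 Lg.
rewrite -ip_linr // ipC [RHS]ipC; apply: ip_aeq => //.
- by apply: markov_L2; apply: L2_lin.
- exact: L2_lin.
- exact: Plin.
Qed.

Lemma ipP0 h : L2 mu h -> ip mu h (P (fun=> 0)) = 0.
Proof.
move=> Lh; have := ipP_lin (-1) (L2_cst mu 0) (L2_cst mu 0) Lh.
have -> : (fun x : T => -1 * (0 : R) + 0) = (fun=> 0).
  by apply/funext => x; rewrite mulr0 addr0.
by rewrite mulN1r addNr.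
Qed.

Lemma ipP_scale a f h : L2 mu f -> L2 mu h ->
  ip mu h (P (fun x => a * f x)) = a * ip mu h (P f).
Proof.
move=> Lf Lh; rewrite -[RHS]addr0 -(ipP0 Lh) -ipP_lin //; last exact: L2_cst.
by congr (ip mu _ (P _)); apply/funext => x; rewrite addr0.
Qed.

Lemma ipP_sub f g h : L2 mu f -> L2 mu g -> L2 mu h ->
  ip mu h (P (fun x => f x - g x)) = ip mu h (P f) - ip mu h (P g).
Proof.
move=> Lf Lg Lh; rewrite addrC -mulN1r -ipP_lin //.
by congr (ip mu _ (P _)); apply/funext => x; rewrite mulN1r addrC.
Qed.

Lemma ipP_sum (I : Type) (r : seq I) (c : I -> R) (F : I -> T -> R) h :
  (forall i, L2 mu (F i)) -> L2 mu h ->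
  ip mu h (P (fun x => \sum_(i <- r) c i * F i x)) =
  \sum_(i <- r) c i * ip mu h (P (F i)).
Proof.
move=> LF Lh; elim: r => [|i r IH].
  by under eq_fun do rewrite big_nil; rewrite big_nil ipP0.
under eq_fun do rewrite big_cons.
by rewrite big_cons ipP_lin ?IH //; exact: L2_sum.
Qed.

Lemma ipP1 f : L2 mu f -> ip mu f (P (fun=> 1)) = ip mu f (fun=> 1).
Proof.
move=> Lf; have [_ P1 _] := PM; rewrite ipC [RHS]ipC.
by apply: ip_aeq => //; [apply: markov_L2|]; apply: L2_cst.
Qed.

Lemma ipP_ge0 f g : L2 mu f -> L2 mu g -> (forall x, 0 <= f x) ->
  (forall x, 0 <= g x) -> 0 <= ip mu f (P g).
Proof.
move=> Lf Lg f0 g0; have [_ _ Ppos] := PM.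
apply: ip_pos => //; first exact: markov_L2.
- by apply: nearW => x; apply: f0.
- by apply: Ppos => //; apply: nearW => x; apply: g0.
Qed.

(** * The weighted graph induced by [P] on a finite partition *)

Section Coding.
Variables (V : finType) (c : T -> V).
Hypothesis mc : forall v, measurable (c @^-1` [set v]).

Definition coding_weight u v : R :=
  ip mu \1_(c @^-1` [set u]) (P \1_(c @^-1` [set v])).

Local Notation w := coding_weight.
Local Notation fib v := (\1_(c @^-1` [set v]) : T -> R).
Let Lfib v : L2 mu (fib v). Proof. exact: L2_indic. Qed.

Lemma coding_weight_ge0 u v : 0 <= w u v.
Proof. by apply: ipP_ge0 => //; try exact: L2_indic. Qed.

Lemma coding_weightC u v : w u v = w v u.
Proof. by apply: PR; apply: L2_indic. Qed.

(** This is [P 1 = 1] tested against the indicator of a cell: vertex degrees are measures of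
    cells. *)
Lemma coding_weight_row u : \sum_v w u v = fine (mu (c @^-1` [set u])).
Proof.
transitivity (ip mu (fib u) (P (fun=> 1))).
  have -> : (fun=> 1) = (fun x => \sum_v 1 * fib v x).
    by apply/funext => x; rewrite -(coding_sum c (fun=> 1)).
  by rewrite ipP_sum //; apply: eq_bigr => v _; rewrite mul1r.
rewrite ipP1 //; have -> : (fun=> 1) = \1_setT :> (T -> R).
  by apply/funext => x; rewrite indicT.
by rewrite ip_indic // setIT.
Qed.

Lemma ipP_coding (phi psi : V -> R) :
  ip mu (fun x => phi (c x)) (P (fun x => psi (c x))) =
  \sum_u \sum_v w u v * (phi u * psi v).
Proof.
rewrite [in LHS](coding_sumE c phi) ip_suml //; last first.
  by apply: markov_L2; apply: L2_coding.
apply: eq_bigr => u _; rewrite (coding_sumE c psi) ipP_sum // mulr_sumr.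
by apply: eq_bigr => v _; rewrite /coding_weight; ring.
Qed.

Lemma ip_coding (phi psi : V -> R) :
  ip mu (fun x => phi (c x)) (fun x => psi (c x)) =
  \sum_u (\sum_v w u v) * (phi u * psi u).
Proof.
rewrite [in LHS](coding_sumE c phi) ip_suml //; last exact: L2_coding.
apply: eq_bigr => u _; rewrite coding_weight_row.
rewrite ipC (coding_sumE c psi) ip_suml //.
rewrite (bigD1 u) //= big1 ?addr0; last first.
  move=> v vu; rewrite ip_indic // [_ `&` _](_ : _ = set0) ?measure0 ?mulr0 //.
  by apply/seteqP; split => // x /= [-> e]; rewrite e eqxx in vu.
by rewrite ip_indic // setIid; ring.
Qed.

(** Right side minus left side is the sum of [w u v * (phi u - psi v) ^ 2], because rows and columns
    of [w] both sum to the measure of the cells. *)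
Lemma contraction_coding (phi psi : V -> R) :
  2 * ip mu (fun x => phi (c x)) (P (fun x => psi (c x))) <=
  ip mu (fun x => phi (c x)) (fun x => phi (c x)) +
  ip mu (fun x => psi (c x)) (fun x => psi (c x)).
Proof.
rewrite ipP_coding !ip_coding.
have -> : \sum_u (\sum_v w u v) * (psi u * psi u) = \sum_u \sum_v w u v * (psi v * psi v).
  rewrite exchange_big /=; apply: eq_bigr => u _; rewrite mulr_suml.
  by apply: eq_bigr => v _; rewrite coding_weightC.
rewrite mulr_sumr -big_split /=; apply: ler_sum => u _.
rewrite mulr_suml mulr_sumr -big_split /=; apply: ler_sum => v _.
have h := sqr_ge0 (phi u - psi v); have wuv := coding_weight_ge0 u v.
rewrite -subr_ge0 (_ : _ - _ = w u v * (phi u - psi v) ^+ 2); last by ring.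
by rewrite mulr_ge0.
Qed.

Lemma ipP_indic_coding (A B : {set V}) :
  ip mu \1_(c @^-1` [set` A]) (P \1_(c @^-1` [set` B])) =
  \sum_(u in A) \sum_(v in B) w u v.
Proof.
have e (U : {set V}) : \1_(c @^-1` [set` U]) = (fun x => (c x \in U)%:R) :> (T -> R).
  by apply/funext => x; rewrite indic_coding.
rewrite !e (ipP_coding (fun v => (v \in A)%:R) (fun v => (v \in B)%:R)).
rewrite [RHS]big_mkcond; apply: eq_bigr => u _; case: ifP => uA; last first.
  by rewrite big1 // => v _; rewrite mul0r mulr0.
by rewrite [RHS]big_mkcond; apply: eq_bigr => v _; case: ifP; rewrite mul1r ?mulr1 ?mulr0.
Qed.

Lemma measure_coding (A : {set V}) :
  fine (mu (c @^-1` [set` A])) = \sum_(u in A) \sum_v w u v.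
Proof.
have mA := measurable_coding mc A.
have <- : ip mu \1_(c @^-1` [set` A]) \1_(c @^-1` [set` A]) = fine (mu (c @^-1` [set` A])).
  by rewrite ip_indic // setIid.
have -> : \1_(c @^-1` [set` A]) = (fun x => (c x \in A)%:R) :> (T -> R).
  by apply/funext => x; rewrite indic_coding.
rewrite (ip_coding (fun v => (v \in A)%:R) (fun v => (v \in A)%:R)) [RHS]big_mkcond.
by apply: eq_bigr => u _; case: ifP; rewrite ?mulr1 ?mulr0.
Qed.
End Coding.

Lemma simple_approx_ip f g (t : R) : L2 mu f -> L2 mu g -> 0 < t -> t <= 1 ->
  exists (V : finType) (c : T -> V) (phi : V -> R),
    let s x := phi (c x) in
    [/\ forall v, measurable (c @^-1` [set v]),
      ip mu f g <= ip mu s g + t * (1 + ip mu g g) &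
      ip mu s s <= ip mu f f + t * (2 + ip mu f f)].
Proof.
move=> Lf Lg t0 t1; have [V [c [phi [mc h]]]] := simple_approx Lf (exprn_gt0 2 t0).
exists V, c, phi => s; have Ls : L2 mu s by apply: L2_coding.
have Ld := L2_sub Lf Ls; set dd := ip mu _ _ in h.
have dt : t^-1 * dd <= t by rewrite mulrC ler_pdivrMr // -expr2.
split => //.
- have : 2 * (ip mu f g - ip mu s g) <= t * ip mu g g + t.
    rewrite -ip_subl // ipC; apply: le_trans (ip_young t0 Lg Ld) _.
    by rewrite lerD2l.
  have := ip_ge0 mu g; nra.
- have e : ip mu s s = ip mu f f - 2 * ip mu f (fun x => f x - s x) + dd.
    rewrite /dd ip_subl // ![ip mu _ (fun x => f x - s x)]ipC !ip_subl //.
    by rewrite (ipC _ s f); ring.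
  rewrite e; have := ip_young t0 (L2_scale (-1) Lf) Ld.
  rewrite !ip_scalel //; last exact: L2_scale.
  rewrite (ipC _ f (fun x => -1 * f x)) ip_scalel // -/dd.
  have : dd <= t by apply: le_trans h _; rewrite expr2; nra.
  have := ip_ge0 mu f; nra.
Qed.

(** If [b < a], the chosen [t] satisfies [t <= 1] and [t * C < a - b], a contradiction. *)
Lemma le_eps_lin (a b C : R) : 0 <= C ->
  (forall t : R, 0 < t -> t <= 1 -> a <= b + t * C) -> a <= b.
Proof.
move=> C0 h; rewrite leNgt; apply/negP => ba.
have C1 : 0 < 2 * (C + 1) + (a - b) by lra.
pose t := (a - b) / (2 * (C + 1) + (a - b)).
have t0 : 0 < t by rewrite divr_gt0 // subr_gt0.
have tE : t * (2 * (C + 1) + (a - b)) = a - b by rewrite divfK // gt_eqF.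
have t1 : t <= 1 by rewrite ler_pdivrMr // mul1r; lra.
have := h t t0 t1; nra.
Qed.

(** Continuity of [P] is not given in advance, so nothing is approximated inside [P]. First [f] is
    approximated with [P g] fixed and [g] simple; then reversibility moves [P] onto [f], and [g] is
    approximated with [P f] fixed. *)
Lemma markov_contraction f g : L2 mu f -> L2 mu g ->
  2 * ip mu f (P g) <= ip mu f f + ip mu g g.
Proof.
have half f' (W : finType) (c' : T -> W) (psi : W -> R) :
    L2 mu f' -> (forall v, measurable (c' @^-1` [set v])) ->
    2 * ip mu f' (P (fun x => psi (c' x))) <= ip mu f' f' +
      ip mu (fun x => psi (c' x)) (fun x => psi (c' x)).
  move=> Lf' mc'; have Lg := L2_coding mu mc' psi.
  set g' := fun x => psi (c' x) in Lg *.
  have LPg := markov_L2 Lg.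
  apply: (@le_eps_lin _ _ (2 * (1 + ip mu (P g') (P g')) + (2 + ip mu f' f'))).
    by have := ip_ge0 mu (P g'); have := ip_ge0 mu f'; lra.
  move=> t t0 t1; have [V [c [phi [mc h1 h2]]]] := simple_approx_ip Lf' LPg t0 t1.
  have mcc (v : V * W) : measurable ((fun x => (c x, c' x)) @^-1` [set v]).
    case: v => v1 v2.
    rewrite (_ : _ @^-1` _ = c @^-1` [set v1] `&` c' @^-1` [set v2]).
      exact: measurableI.
    by apply/seteqP; split => x /= [-> ->].
  have := contraction_coding mcc (fun v => phi v.1) (fun v => psi v.2) => /=.
  rewrite -/g'; lra.
move=> Lf Lg; apply: (@le_eps_lin _ _ (2 * (1 + ip mu (P f) (P f)) + (2 + ip mu g g))).
  by have := ip_ge0 mu (P f); have := ip_ge0 mu g; lra.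
move=> t t0 t1; rewrite -(PR Lf Lg).
have [V [c [phi [mc h1 h2]]]] := simple_approx_ip Lg (markov_L2 Lf) t0 t1.
have := half f _ _ phi Lf mc; rewrite -(PR Lf (L2_coding mu mc phi)); lra.
Qed.
End MarkovForm.

(** * Energy and the upper bound *)

(** A matrix with [n + 1] rows and [n] columns has rank at most [n], so its left kernel is
    nonzero. *)
Lemma kernel_vector (K : fieldType) (n : nat) (M : 'I_n.+1 -> 'I_n -> K) :
  exists c : 'I_n.+1 -> K, (exists i, c i != 0) /\
    forall j, \sum_i c i * M i j = 0.
Proof.
pose A := \matrix_(i < n.+1, j < n) M i j.
have : kermx A != 0.
  rewrite -mxrank_eq0 mxrank_ker -lt0n subn_gt0 ltnS; exact: rank_leq_col.
case/rowV0Pn => v /sub_kermxP vA /rV0Pn[i vi].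
exists (fun i => v 0 i); split; first by exists i.
move=> j; move/matrixP: vA => /(_ 0 j); rewrite !mxE => h.
by rewrite -[RHS]h; apply: eq_bigr => l _; rewrite mxE.
Qed.

Section UpperBound.
Context (d : measure_display) (T : measurableType d) (R : realType)
  (mu : probability T R) (P : (T -> R) -> (T -> R)).
Hypothesis PM : markov_operator mu P.
Hypothesis PR : reversible mu P.
Implicit Types f g h : T -> R.

Definition energy f := ip mu f (fun x => f x + P f x).

Lemma energyE f : L2 mu f -> energy f = ip mu f f + ip mu f (P f).
Proof.
move=> Lf; have LP := markov_L2 PM Lf.
by rewrite /energy ipC ip_addl // (ipC mu (P f)).
Qed.

Lemma energy_ge0 f : L2 mu f -> 0 <= energy f.
Proof.
move=> Lf; rewrite energyE //; have := markov_contraction PM PR (L2_scale (-1) Lf) Lf.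
have LP := markov_L2 PM Lf; have LN := L2_scale (-1) Lf.
rewrite ip_scalel // (ipC mu (fun x => -1 * f x)) !ip_scalel //.
by rewrite (ipC mu f (fun x => -1 * f x)) ip_scalel //; lra.
Qed.

Lemma energy_le f : L2 mu f -> energy f <= 2 * ip mu f f.
Proof.
by move=> Lf; rewrite energyE //; have := markov_contraction PM PR Lf Lf; lra.
Qed.

Lemma energy_scale a f : L2 mu f -> energy (fun x => a * f x) = a ^+ 2 * energy f.
Proof.
move=> Lf; have LN := L2_scale a Lf; have LP := markov_L2 PM Lf.
have LPN := markov_L2 PM LN.
rewrite !energyE // (ip_scalel _ Lf LN) (ip_scalel _ Lf LPN).
by rewrite (ipP_scale PM) // (ipC mu f (fun x => a * f x)) ip_scalel //; ring.
Qed.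

(** Signless Dirichlet form of the graph. The squares [phi u ^ 2] and [phi v ^ 2] contribute the
    norm once each, hence the factor [1 / 2]. *)
Lemma energy_coding (V : finType) (c : T -> V) (phi : V -> R) :
  (forall v, measurable (c @^-1` [set v])) ->
  energy (fun x => phi (c x)) =
  2^-1 * \sum_u \sum_v coding_weight mu P c u v * (phi u + phi v) ^+ 2.
Proof.
move=> mc; rewrite energyE; last exact: L2_coding.
rewrite (ipP_coding PM mc) (ip_coding PM mc).
have e : \sum_u (\sum_v coding_weight mu P c u v) * (phi u * phi u) =
    \sum_u \sum_v coding_weight mu P c u v * (phi v * phi v).
  rewrite exchange_big /=; apply: eq_bigr => u _; rewrite mulr_suml.
  by apply: eq_bigr => v _; rewrite (coding_weightC PR).
have half (X Y Z : R) : X = Y -> X + Z = 2^-1 * (X + Y + 2 * Z) by move=> ->; field.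
rewrite (half _ _ _ e).
congr (_ * _); rewrite mulr_sumr -!big_split /=; apply: eq_bigr => u _.
rewrite mulr_sumr mulr_suml -!big_split /=; apply: eq_bigr => v _; ring.
Qed.

Lemma ip_gt0 f : L2 mu f -> ~ {ae mu, forall x, f x = 0} -> 0 < ip mu f f.
Proof.
by move=> Lf nf; rewrite lt_def ip_ge0 andbT; apply: contra_notN nf => /eqP/(ip_eq0 Lf).
Qed.

Lemma ip_ae0 f : L2 mu f -> {ae mu, forall x, f x = 0} -> ip mu f f = 0.
Proof. by move=> Lf f0; rewrite (ip_aeq Lf (L2_cst mu 0) Lf f0) ip0l. Qed.

(** The pairs become a finite partition: [true] marks [A i], [false] marks [B i], and [None] is the
    complement of their union. *)
Lemma admissible_coding (k : nat) (A B : 'I_k -> set T) : admissible_pairs mu A B ->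
  exists c : T -> option ('I_k * bool), (forall v, measurable (c @^-1` [set v])) /\
   forall i, c @^-1` [set Some (i, true)] = A i /\ c @^-1` [set Some (i, false)] = B i.
Proof.
case=> mAB disj AB0 _.
pose c x := if [pick i | `[< A i x >]] is Some i then Some (i, true) else
  if [pick i | `[< B i x >]] is Some i then Some (i, false) else None.
have E0 (X Y : set T) x : X `&` Y = set0 -> X x -> Y x -> False.
  by move=> XY Xx Yx; have : (X `&` Y) x by []; rewrite XY.
have cA i x : A i x -> c x = Some (i, true).
  move=> Ax; rewrite /c; case: pickP => [j /asboolP Aj|/(_ i)]; last first.
    by move/asboolP; case.
  have [->//|ji] := eqVneq j i.
  by have [/E0/(_ Aj Ax)] := disj _ _ ji.
have cB i x : B i x -> c x = Some (i, false).
  move=> Bx; rewrite /c; case: pickP => [j /asboolP Aj|_].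
    by have /E0/(_ Aj Bx) := AB0 j i.
  case: pickP => [j /asboolP Bj|/(_ i)]; last by move/asboolP; case.
  have [->//|ji] := eqVneq j i.
  by have [_ /E0/(_ Bj Bx)] := disj _ _ ji.
have fA i : c @^-1` [set Some (i, true)] = A i.
  apply/seteqP; split=> x /=; last exact: cA.
  rewrite /c; case: pickP => [j /asboolP Aj [<-] //|_].
  by case: pickP.
have fB i : c @^-1` [set Some (i, false)] = B i.
  apply/seteqP; split=> x /=; last exact: cB.
  rewrite /c; case: pickP => // _.
  by case: pickP => [j /asboolP Aj [<-] //|_].
exists c; split=> // v.
have mS p : measurable (c @^-1` [set Some p]).
  by case: p => i [|]; rewrite ?fA ?fB; have [] := mAB i.
case: v => [//|].
rewrite (_ : _ @^-1` _ = ~` \bigcup_(p in [set: 'I_k * bool]) c @^-1` [set Some p]).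
  by apply: measurableC; apply: fin_bigcup_measurable => // p _.
apply/seteqP; split => [x /= xN [p _ /=]|x /= xN]; first by rewrite xN.
by case cp: (c x) => [p|//]; case: xN; exists p.
Qed.

Lemma admissible_test_function (n : nat) (A B : 'I_n.+1 -> set T)
    (fs : 'I_n -> T -> R) (r : R) :
  admissible_pairs mu A B -> (forall i, L2 mu (fs i)) ->
  (forall i, r <= 2 * ip mu \1_(A i) (P \1_(B i)) / fine (mu (A i `|` B i))) ->
  exists f, [/\ L2 mu f, ~ {ae mu, forall x, f x = 0}, forall i, ip mu f (fs i) = 0 &
    energy f <= 2 * (1 - r) * ip mu f f].
Proof.
move=> adm Lfs hr; have [mAB disj AB0 AB1] := adm.
have [c [mc fib]] := admissible_coding adm.
pose w := coding_weight mu P c.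
pose m (p : 'I_n.+1 * bool) := \sum_v w (Some p) v.
have mE p : m p = fine (mu (c @^-1` [set Some p])) by rewrite /m coding_weight_row.
have mS i : m (i, true) + m (i, false) = fine (mu (A i `|` B i)).
  have [eA eB] := fib i; have [mA mB] := mAB i.
  by rewrite !mE eA eB (measureU mu mA mB (AB0 i i)) fineD // fin_num_measure.
have mS0 i : 0 < m (i, true) + m (i, false).
  rewrite mS; apply: fine_gt0; rewrite AB1 /=.
  by rewrite ltey_eq fin_num_measure //; have [mA mB] := mAB i; exact: measurableU.
have wE i : w (Some (i, true)) (Some (i, false)) = ip mu \1_(A i) (P \1_(B i)).
  by have [eA eB] := fib i; rewrite /w /coding_weight eA eB.
have hr' i : r * (m (i, true) + m (i, false)) <= 2 * w (Some (i, true)) (Some (i, false)).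
  by rewrite wE -ler_pdivlMr // mS.
pose g i x : R := \1_(A i) x - \1_(B i) x.
have Lg i : L2 mu (g i).
  by have [mA mB] := mAB i; apply: L2_sub; apply: L2_indic.
have [a [[i0 ai0] ha]] := kernel_vector (fun i j => ip mu (g i) (fs j)).
pose phi (v : option ('I_n.+1 * bool)) : R :=
  if v is Some (i, b) then (if b then a i else - a i) else 0.
have phiE : (fun x => phi (c x)) = (fun x => \sum_i a i * g i x).
  apply/funext => x; rewrite /g.
  have gE i : \1_(A i) x - \1_(B i) x = (c x == Some (i, true))%:R - (c x == Some (i, false))%:R :> R.
    have [<- <-] := fib i; rewrite !indicE.
    by congr ((nat_of_bool _)%:R - (nat_of_bool _)%:R); apply/idP/eqP; rewrite inE.
  under eq_bigr do rewrite gE.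
  case: (c x) => [[j b]|]; last by rewrite big1 // => i _; rewrite subrr mulr0.
  rewrite (bigD1 j) //= big1 ?addr0 => [|i ij]; last first.
    have e b' : (Some (j, b) == Some (i, b')) = false.
      by apply/eqP => -[e _]; rewrite e eqxx in ij.
    by rewrite !e subrr mulr0.
  have e1 b' : (Some (j, b) == Some (j, b')) = (b == b').
    by apply/eqP/eqP => [[]|->].
  rewrite !e1 {e1}; by case: b => /=; rewrite ?subr0 ?mulr1 ?sub0r ?mulrN1.
have optsum (F : option ('I_n.+1 * bool) -> R) : \sum_v F v =
    F None + \sum_i (F (Some (i, true)) + F (Some (i, false))).
  rewrite (bigD1 None) //=; congr (_ + _).
  rewrite (reindex_omap Some id) /=; last by case.
  rewrite (eq_bigl xpredT) => [|p]; last by rewrite eqxx.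
  have -> : \sum_p F (Some p) = \sum_i \sum_b F (Some (i, b)).
    by rewrite pair_bigA; apply: eq_bigr => -[].
  apply: eq_bigr => i _.
  by rewrite (bigD1 true) //= (bigD1 false) //= big1 ?addr0 // => -[].
have Lf := L2_coding mu mc phi.
have normE : ip mu (fun x => phi (c x)) (fun x => phi (c x)) =
    \sum_i a i ^+ 2 * (m (i, true) + m (i, false)).
  rewrite (ip_coding PM mc) optsum /= !mulr0 add0r; apply: eq_bigr => i _.
  by rewrite /m; ring.
exists (fun x => phi (c x)); split => //.
- move=> /(ip_ae0 Lf); rewrite normE => /eqP; rewrite psumr_eq0.
    move=> /allP/(_ i0 (mem_index_enum _)); rewrite mulf_eq0 sqrf_eq0 (negPf ai0) /=.
    by rewrite gt_eqF.
  by move=> i _; rewrite mulr_ge0 ?sqr_ge0 // ltW.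
- by move=> j; rewrite phiE ip_suml // ha.
- rewrite (energy_coding _ mc).
  pose flip (v : option ('I_n.+1 * bool)) := if v is Some (i, b) then Some (i, ~~ b) else None.
  have phiN v : phi (flip v) = - phi v by case: v => [[i [|]]|] /=; rewrite ?opprK ?oppr0.
  have flipK : involutive flip by case=> [[i [|]]|].
  have w0 u v : 0 <= w u v by apply: coding_weight_ge0.
  (* [flip] exchanges the two sets of a pair, and [phi] changes sign under it. The edge from [u] to
     [flip u] thus contributes 0, saving the [4 * w u (flip u) * phi u ^+ 2] charged by the general
     bound. *)
  have step u : \sum_v w u v * (phi u + phi v) ^+ 2 <=
      \sum_v w u v * (2 * (phi u ^+ 2 + phi v ^+ 2)) - 4 * w u (flip u) * phi u ^+ 2.
    rewrite lerBrDr (bigD1 (flip u)) //= [leRHS](bigD1 (flip u)) //=.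
    rewrite phiN subrr expr0n mulr0 add0r addrC sqrrN lerD //; last first.
      by rewrite le_eqVlt; apply/orP; left; apply/eqP; ring.
    apply: ler_sum => v _; rewrite ler_wpM2l //.
    by have := sqr_ge0 (phi u - phi v); lra.
  apply: (@le_trans _ _ (2^-1 * \sum_u (\sum_v w u v * (2 * (phi u ^+ 2 + phi v ^+ 2))
      - 4 * w u (flip u) * phi u ^+ 2))).
    by rewrite ler_wpM2l ?invr_ge0 //; apply: ler_sum.
  rewrite sumrB.
  have -> : \sum_u \sum_v w u v * (2 * (phi u ^+ 2 + phi v ^+ 2)) =
      4 * ip mu (fun x => phi (c x)) (fun x => phi (c x)).
    rewrite (ip_coding PM mc) -/w.
    have e : \sum_u \sum_v w u v * phi v ^+ 2 = \sum_u (\sum_v w u v) * (phi u * phi u).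
      rewrite exchange_big /=; apply: eq_bigr => u _; rewrite mulr_suml.
      by apply: eq_bigr => v _; rewrite expr2 /w (coding_weightC PR).
    have -> : 4 * \sum_u (\sum_v w u v) * (phi u * phi u) =
      2 * \sum_u (\sum_v w u v) * (phi u * phi u) + 2 * \sum_u \sum_v w u v * phi v ^+ 2.
      by rewrite e; ring.
    rewrite !mulr_sumr -big_split /=; apply: eq_bigr => u _.
    rewrite mulr_sumr mulr_suml mulr_sumr -big_split /=; apply: eq_bigr => v _; ring.
  rewrite normE (optsum (fun u => 4 * w u (flip u) * phi u ^+ 2)) /= expr0n mulr0 add0r.
  have -> : \sum_i (4 * w (Some (i, true)) (Some (i, false)) * a i ^+ 2 +
      4 * w (Some (i, false)) (Some (i, true)) * (- a i) ^+ 2) =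
      4 * \sum_i (2 * w (Some (i, true)) (Some (i, false))) * a i ^+ 2.
    rewrite mulr_sumr; apply: eq_bigr => i _.
    have -> : w (Some (i, false)) (Some (i, true)) = w (Some (i, true)) (Some (i, false)).
      exact: coding_weightC.
    ring.
  have : \sum_i r * (a i ^+ 2 * (m (i, true) + m (i, false))) <=
      \sum_i (2 * w (Some (i, true)) (Some (i, false))) * a i ^+ 2.
    apply: ler_sum => i _; rewrite mulrCA mulrC ler_wpM2r ?sqr_ge0 //.
  rewrite -mulr_sumr; lra.
Qed.
End UpperBound.

(** * The lower bound *)

Section LowerBound.
Context (d : measure_display) (T : measurableType d) (R : realType)
  (mu : probability T R) (P : (T -> R) -> (T -> R)).
Hypothesis PM : markov_operator mu P.
Hypothesis PR : reversible mu P.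
Implicit Types f g h : T -> R.

(* Only the constraints of orthogonality to the functions already chosen are
   needed, so the definition of [lambdabar] provides the next function at once. *)
Lemma greedy_orthonormal (n : nat) (lam : R) : (lambdabar mu P n.+1 < lam%:E)%E ->
  forall m, (m <= n.+1)%N -> exists f : nat -> T -> R,
    [/\ forall i, L2 mu (f i),
      forall i j, (i < m)%N -> (j < m)%N -> ip mu (f i) (f j) = (i == j)%:R &
      forall i, (i < m)%N -> energy mu P (f i) <= lam].
Proof.
move=> hlam; elim=> [|m IH] mn.
  by exists (fun _ _ => 0); split => // i; apply: L2_cst.
have [f [Lf orth en]] := IH (ltnW mn).
(* The definition asks for exactly [n] constraints while only [m <= n] functions are chosen; the
   family is padded with zeros. *)
pose fs (i : 'I_n) := if (i < m)%N then f i else (fun=> 0).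
have Lfs i : L2 mu (fs i) by rewrite /fs; case: ifP => // _; apply: L2_cst.
have : (ereal_inf [set (rayleigh mu P g)%:E | g in
    [set g | L2 mu g /\ ~ {ae mu, forall x, g x = 0%R} /\
      forall i, ip mu g (fs i) = 0%R]] < lam%:E)%E.
  by apply: le_lt_trans hlam; apply: ereal_sup_ubound; exists fs.
move=> /ereal_inf_lt[_ [g [Lg [ng gfs]] <-]]; rewrite lte_fin => rg.
have gg := ip_gt0 Lg ng.
pose s := (Num.sqrt (ip mu g g))^-1.
have s2 : s ^+ 2 = (ip mu g g)^-1 by rewrite exprVn sqr_sqrtr // ltW.
have Lsg := L2_scale s Lg.
have gf i : (i < m)%N -> ip mu g (f i) = 0.
  move=> im; have iN : (i < n)%N by apply: leq_trans im _.
  by have := gfs (Ordinal iN); rewrite /fs /= im.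
exists (fun i => if i == m then (fun x => s * g x) else f i); split.
- by move=> i; case: ifP.
- move=> i j; rewrite !ltnS; case: (eqVneq i m) => [->|im] ile; case: (eqVneq j m) => [->|jm] jle.
  + rewrite ip_scalel // ipC ip_scalel // mulrA -expr2 s2 mulVf ?eqxx //.
    by rewrite gt_eqF.
  + by rewrite ip_scalel // gf ?mulr0 ?ltn_neqAle ?jm // eq_sym (negPf jm).
  + by rewrite ipC ip_scalel // gf ?mulr0 ?ltn_neqAle ?im // (negPf im).
  + by rewrite orth // ltn_neqAle ?im ?jm.
- move=> i; rewrite ltnS; case: (eqVneq i m) => [->|im] ile; last first.
    by rewrite en // ltn_neqAle im.
  by rewrite (energy_scale PM) // s2 mulrC ltW.
Qed.

(** Pairing codings gives a common refinement, so all the approximants live on one partition. *)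
Lemma joint_simple_approx (f : nat -> T -> R) (e : R) (m : nat) :
  (forall i, L2 mu (f i)) -> 0 < e ->
  exists (V : finType) (c : T -> V) (phi : nat -> V -> R),
    (forall v, measurable (c @^-1` [set v])) /\
    forall i, (i < m)%N ->
      ip mu (fun x => f i x - phi i (c x)) (fun x => f i x - phi i (c x)) <= e.
Proof.
move=> Lf e0; elim: m => [|m [V [c [phi [mc h]]]]].
  exists unit, (fun=> tt), (fun _ _ => 0); split=> // -[].
  by rewrite (_ : _ @^-1` _ = setT) //; apply/seteqP; split.
have [V' [c' [psi [mc' h']]]] := simple_approx (Lf m) e0.
exists (V * V')%type, (fun x => (c x, c' x)),
  (fun i v => if i == m then psi v.2 else phi i v.1); split.
  move=> [u v]; rewrite (_ : _ @^-1` _ = c @^-1` [set u] `&` c' @^-1` [set v]).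
    exact: measurableI.
  by apply/seteqP; split => x /= [-> ->].
move=> i; rewrite ltnS; case: (eqVneq i m) => [->//|im] ile.
by apply: h; rewrite ltn_neqAle im.
Qed.

(** With errors [f - f'] and [g - g'], the difference is the product of the errors minus each error
    paired with the other exact function. Young's inequality with weight [t^-1] bounds each mixed
    term by [t], and the product by [t ^ 2 <= t]. *)
Lemma ip_perturb f g f' g' (t : R) : L2 mu f -> L2 mu g -> L2 mu f' -> L2 mu g' ->
  0 < t -> t <= 1 -> ip mu f f = 1 -> ip mu g g = 1 ->
  ip mu (fun x => f x - f' x) (fun x => f x - f' x) <= t ^+ 2 ->
  ip mu (fun x => g x - g' x) (fun x => g x - g' x) <= t ^+ 2 ->
  `|ip mu f' g' - ip mu f g| <= 3 * t.
Proof.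
move=> Lf Lg Lf' Lg' t0 t1 f1 g1 hf hg.
have Le := L2_sub Lf Lf'; have Lh := L2_sub Lg Lg'.
have ti : 0 < t^-1 by rewrite invr_gt0.
have tt2 : t^-1 * t ^+ 2 = t by rewrite expr2 mulKf // gt_eqF.
have y1 := ip_young_abs ti Le Lg; have y2 := ip_young_abs ti Lh Lf.
have y3 := ip_young_abs ltr01 Le Lh.
have e3 : ip mu (fun x => f x - f' x) (fun x => g x - g' x) =
   ip mu f g - ip mu f g' - (ip mu f' g - ip mu f' g').
  rewrite ip_subl // ![ip mu _ (fun x => g x - g' x)]ipC !ip_subl //.
  by rewrite ![ip mu g _]ipC ![ip mu g' _]ipC.
have e1 : ip mu (fun x => f x - f' x) g = ip mu f g - ip mu f' g by rewrite ip_subl.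
have e2 : ip mu (fun x => g x - g' x) f = ip mu f g - ip mu f g'.
  by rewrite ip_subl // ipC [ip mu g' f]ipC.
have -> : ip mu f' g' - ip mu f g = ip mu (fun x => f x - f' x) (fun x => g x - g' x)
   - ip mu (fun x => f x - f' x) g - ip mu (fun x => g x - g' x) f by lra.
have tt : t ^+ 2 <= t by rewrite expr2; nra.
move: y1 y2 y3; rewrite f1 g1 invrK invr1 !mul1r !mulr1 => y1 y2 y3.
have z1 := ler_wpM2l (ltW ti) hf; have z2 := ler_wpM2l (ltW ti) hg.
rewrite tt2 in z1 z2.
apply: le_trans (ler_normB _ _) _; apply: le_trans (lerD (ler_normB _ _) (lexx _)) _.
lra.
Qed.

(** Expanding the quadratic form at [f' = f - (f - f')], the energy of the error is at most [2 * t]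
    and the two cross terms, against [f] and [P f], at most [2 * t] each. *)
Lemma energy_perturb f f' (t : R) : L2 mu f -> L2 mu f' -> 0 < t -> t <= 1 ->
  ip mu f f = 1 ->
  ip mu (fun x => f x - f' x) (fun x => f x - f' x) <= t ^+ 2 ->
  energy mu P f' <= energy mu P f + 6 * t.
Proof.
move=> Lf Lf' t0 t1 f1 hf; have Le := L2_sub Lf Lf'.
have LPf := markov_L2 PM Lf; have LPf' := markov_L2 PM Lf'.
have := energy_le PM PR Le; rewrite (energyE PM Le) (energyE PM Lf) (energyE PM Lf').
have ti : 0 < t^-1 by rewrite invr_gt0.
have tt2 : t^-1 * t ^+ 2 = t by rewrite expr2 mulKf // gt_eqF.
have tt : t ^+ 2 <= t by rewrite expr2; nra.
have z1 := ler_wpM2l (ltW ti) hf; rewrite tt2 in z1.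
have Pf1 : ip mu (P f) (P f) <= 1.
  by have := markov_contraction PM PR LPf Lf; lra.
have y1 := ip_young ti (L2_scale (-1) Le) Lf.
have y2 := ip_young ti (L2_scale (-1) Le) LPf.
have LN := L2_scale (-1) Le.
rewrite !(ip_scalel (-1) Le) // ![ip mu _ (fun x => -1 * _)]ipC !(ip_scalel (-1) Le) // in y1 y2.
set E := ip mu (fun x => f x - f' x) (fun x => f x - f' x) in hf z1 y1 y2 *.
have e1 : E = ip mu f f - 2 * ip mu f f' + ip mu f' f'.
  rewrite /E ip_subl // ![ip mu _ (fun x => f x - f' x)]ipC !ip_subl //.
  by rewrite [ip mu f' f]ipC; ring.
have e2 : ip mu (fun x => f x - f' x) f = ip mu f f - ip mu f f'.
  by rewrite ip_subl // [ip mu f' f]ipC.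
have e3 : ip mu (fun x => f x - f' x) (P f) = ip mu f (P f) - ip mu f' (P f).
  by rewrite ip_subl.
have e4 : ip mu (fun x => f x - f' x) (P (fun x => f x - f' x)) =
  ip mu f (P f) - 2 * ip mu f' (P f) + ip mu f' (P f').
  rewrite (ipP_sub PM) // !ip_subl // (PR Lf' Lf); ring.
rewrite e4; move: y1 y2; rewrite e2 e3 invrK f1.
have := ler_wpM2l (ltW t0) Pf1; lra.
Qed.

Lemma admissible_near_spectrum (n : nat) (lam : R) :
  (lambdabar mu P n.+1 < lam%:E)%E -> 0 < lam ->
  exists A B : 'I_n.+1 -> set T, admissible_pairs mu A B /\
    forall i, 1 - 77 * n.+1%:R ^+ 3 * Num.sqrt (2 * lam) <=
      2 * ip mu \1_(A i) (P \1_(B i)) / fine (mu (A i `|` B i)).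
Proof.
move=> hlam lam0; set k := n.+1.
have k1 : 1 <= k%:R :> R by rewrite ler1n.
have [f [Lf orth en]] := greedy_orthonormal hlam (leqnn _).
(* The three terms ensure in turn that Gram entries move by at most [1 / (8 * k ^ 2)], that energies
   grow by at most [lam], and that the perturbation lemmas apply. *)
pose t := Num.min (24 * k%:R ^+ 2)^-1 (Num.min (lam / 6) 1).
have t0 : 0 < t by rewrite !lt_min invr_gt0 mulr_gt0 ?exprn_gt0 ?ltr0n ?divr_gt0 ?ltr01.
have t1 : t <= 1 by rewrite !ge_min lexx !orbT.
have tlam : 6 * t <= lam.
  have : t <= lam / 6 by rewrite !ge_min lexx !orbT.
  by lra.
have tk : 3 * t <= (8 * k%:R ^+ 2)^-1.
  have : t <= (24 * k%:R ^+ 2)^-1 by rewrite !ge_min lexx.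
  have -> : (24 * k%:R ^+ 2)^-1 = (8 * k%:R ^+ 2)^-1 / 3 :> R.
    by field; rewrite pnatr_eq0.
  by lra.
have [V [c [phi [mc h]]]] := joint_simple_approx k Lf (exprn_gt0 2 t0).
pose g (i : nat) x := phi i (c x).
have Lg i : L2 mu (g i) by apply: L2_coding.
have gram (i j : 'I_k) : `|ip mu (g i) (g j) - (i == j)%:R| <= 3 * t.
  rewrite -(orth i j) //; apply: ip_perturb => //.
  - by rewrite orth // eqxx.
  - by rewrite orth // eqxx.
  - exact: h.
  - exact: h.
pose w := coding_weight mu P c; pose F v (j : 'I_k) := phi j v.
have w0 u v : 0 <= w u v by apply: coding_weight_ge0.
have wC u v : w u v = w v u by apply: coding_weightC.
have ipF (i j : 'I_k) : ip mu (g i) (g j) = \sum_u (\sum_v w u v) * (F u i * F u j).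
  exact: (ip_coding PM mc).
(* The form is the Gram matrix of the [g i] evaluated at [v]. Its entries differ from the identity
   by at most [1 / (8 * k ^ 2)], and summing [|v i * v j| <= (v i ^ 2 + v j ^ 2) / 2] over all pairs
   costs a factor [k]. *)
have iso (v : 'I_k -> R) : \sum_x (\sum_y w x y) * (\sum_j v j * F x j) ^+ 2 <=
    (1 + (8 * k%:R)^-1) * \sum_j v j ^+ 2.
  have -> : \sum_x (\sum_y w x y) * (\sum_j v j * F x j) ^+ 2 =
      \sum_i \sum_j v i * v j * ip mu (g i) (g j).
    under [RHS]eq_bigr do under eq_bigr do rewrite ipF mulr_sumr.
    under [RHS]eq_bigr do rewrite exchange_big /=.
    rewrite [RHS]exchange_big /=; apply: eq_bigr => x _.
    move: (\sum_y w x y) => mx; rewrite expr2 mulr_suml mulr_sumr; apply: eq_bigr => i _.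
    rewrite !mulr_sumr; apply: eq_bigr => j _; ring.
  have -> : (1 + (8 * k%:R)^-1) * \sum_j v j ^+ 2 = \sum_j v j ^+ 2 +
      \sum_i \sum_(j < k) (8 * k%:R ^+ 2)^-1 * ((v i ^+ 2 + v j ^+ 2) / 2).
    have -> : \sum_i \sum_(j < k) (8 * k%:R ^+ 2)^-1 * ((v i ^+ 2 + v j ^+ 2) / 2) =
      (8 * k%:R ^+ 2)^-1 * ((k%:R * \sum_j v j ^+ 2 + k%:R * \sum_j v j ^+ 2) / 2).
      have d1 : \sum_(i < k) \sum_(j < k) v i ^+ 2 = k%:R * \sum_j v j ^+ 2.
        by rewrite mulr_sumr; apply: eq_bigr => i _; rewrite sumr_const card_ord mulr_natl.
      have d2 : \sum_(i < k) \sum_(j < k) v j ^+ 2 = k%:R * \sum_j v j ^+ 2.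
        by rewrite sumr_const card_ord mulr_natl.
      rewrite -{1}d1 -d2 -big_split /= mulr_suml mulr_sumr; apply: eq_bigr => i _.
      by rewrite -big_split /= mulr_suml mulr_sumr.
    field; rewrite pnatr_eq0 //.
  have -> : \sum_j v j ^+ 2 = \sum_i \sum_j v i * v j * (i == j)%:R.
    apply: eq_bigr => i _; rewrite (bigD1 i) //= eqxx mulr1 big1 ?addr0 // => j ji.
    by rewrite eq_sym (negPf ji) mulr0.
  rewrite -big_split /=; apply: ler_sum => i _.
  rewrite -big_split /=; apply: ler_sum => j _.
  rewrite -lerBlDl -mulrBr; apply: le_trans (ler_norm _) _; rewrite normrM.
  apply: (@le_trans _ _ (`|v i * v j| * (8 * k%:R ^+ 2)^-1)).
    by rewrite ler_wpM2l // (le_trans (gram i j)).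
  rewrite mulrC ler_wpM2l ?invr_ge0 ?mulr_ge0 ?exprn_ge0 //.
  have := sqr_ge0 (v i - v j); have := sqr_ge0 (v i + v j).
  by case: (ger0P (v i * v j)) => _; lra.
have nF x : nrm (F x) ^+ 2 = \sum_(j < k) F x j ^+ 2 by rewrite nrm_sqr.
have mass : k%:R - 1 / 8 <= \sum_x (\sum_y w x y) * nrm (F x) ^+ 2.
  have -> : \sum_x (\sum_y w x y) * nrm (F x) ^+ 2 = \sum_(i < k) ip mu (g i) (g i).
    under eq_bigr do rewrite nF mulr_sumr.
    rewrite exchange_big /=; apply: eq_bigr => i _; rewrite ipF.
    by apply: eq_bigr => x _; rewrite expr2.
  apply: (@le_trans _ _ (\sum_(i < k) (1 - (8 * k%:R ^+ 2)^-1))).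
    rewrite sumr_const card_ord -[leRHS]mulr_natl mulrBr mulr1 lerD2l lerN2.
    rewrite (_ : k%:R * _ = (8 * k%:R)^-1); last by field; rewrite pnatr_eq0.
    by rewrite div1r lef_pV2 ?posrE ?mulr_gt0 ?ltr0n // ler_peMr.
  apply: ler_sum => i _; have := gram i i; rewrite eqxx /= ler_norml => /andP[g1 _].
  by have := tk; lra.
(* The edge sum is twice the total energy of the [g i], each of energy at most [2 * lam]; the graph
   inequality is therefore used with [2 * lam]. *)
have en2 : \sum_x \sum_y w x y * nrm (fun j => F x j + F y j) ^+ 2 <=
    2 * k%:R * (2 * lam).
  have -> : \sum_x \sum_y w x y * nrm (fun j => F x j + F y j) ^+ 2 =
      \sum_(i < k) 2 * energy mu P (g i).
    under eq_bigr do under eq_bigr do rewrite nrm_sqr mulr_sumr.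
    under eq_bigr do rewrite exchange_big /=.
    rewrite exchange_big /=; apply: eq_bigr => i _.
    by rewrite (energy_coding PM PR _ mc) mulrA divff // mul1r.
  apply: (@le_trans _ _ (\sum_(i < k) 2 * (2 * lam))).
    apply: ler_sum => i _; rewrite ler_wpM2l //.
    have := energy_perturb (Lf i) (Lg i) t0 t1; rewrite orth // eqxx.
    move=> /(_ erefl (h _ _)); have := en i (ltn_ord i).
    by move=> ? /(_ (ltn_ord i)); lra.
  by rewrite sumr_const card_ord -[leLHS]mulr_natl; lra.
have [S [pos [Sdis HS]]] := finite_dual_cheeger (ltn0Sn n) w0 wC iso mass
  (mulr_gt0 (ltr0n _ 2) lam0) en2.
pose A i := c @^-1` [set` S i :&: [set x | pos x]].
pose B i := c @^-1` [set` S i :&: [set x | ~~ pos x]].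
have AB i : A i `|` B i = c @^-1` [set` S i].
  apply/seteqP; split=> x; rewrite /A /B /=.
    by case; rewrite !inE => /andP[].
  by move=> xS; case: (boolP (pos (c x))) => px; [left|right]; rewrite /= !inE xS.
have mS i : fine (mu (A i `|` B i)) = \sum_(x in S i) \sum_y w x y.
  by rewrite AB (measure_coding PM mc).
have disS i j x : i != j -> c x \in S i -> c x \in S j -> False.
  move=> ij xi xj; have := Sdis i j ij.
  by rewrite disjoint_subset => /fintype.subsetP/(_ _ xi); rewrite inE xj.
exists A, B; split.
  split.
  - by move=> i; split; apply: measurable_coding.
  - move=> i j ij; split; apply/seteqP; split => // x; rewrite /A /B /= !inE;
    by move=> [/andP[xi _] /andP[xj _]]; apply: disS ij xi xj.
  - move=> i j; apply/seteqP; split => // x; rewrite /A /B /= !inE.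
    by move=> [/andP[_ px] /andP[_]]; rewrite px.
  - move=> i; have [+ _] := HS i; rewrite -mS => h0.
    rewrite lt0e measure_ge0 andbT; apply/eqP => e; by rewrite e ltxx in h0.
move=> i; have [h0 hi] := HS i; rewrite mS ler_pdivlMr //.
apply: le_trans hi _; rewrite /A /B (ipP_indic_coding PM mc) le_eqVlt; apply/orP; left.
apply/eqP; congr (_ * _); apply: eq_big => [x|x _]; first by rewrite !inE.
by apply: eq_bigl => y; rewrite !inE.
Qed.
End LowerBound.

(** * Finiteness of [lambdabar] and [hbar], and the two inequalities *)

Section Bounds.
Context (d : measure_display) (T : measurableType d) (R : realType)
  (mu : probability T R) (P : (T -> R) -> (T -> R)).
Hypothesis dimL2 : L2_infinite_dim mu.
Hypothesis PM : markov_operator mu P.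
Hypothesis PR : reversible mu P.
Variable n : nat.

Lemma rayleigh_ge0 f : L2 mu f -> 0 <= rayleigh mu P f.
Proof. by move=> Lf; rewrite divr_ge0 ?ip_ge0 // (energy_ge0 PM PR). Qed.

Lemma lambdabar_ge0 : (0 <= lambdabar mu P n.+1)%E.
Proof.
apply: (@le_trans _ _ (ereal_inf [set (rayleigh mu P f)%:E | f in
    [set f | L2 mu f /\ ~ {ae mu, forall x, f x = 0%R} /\
      forall i : 'I_n, ip mu f (fun=> 0%R) = 0%R]])).
  apply: le_ereal_inf_tmp => _ [f [Lf _] <-]; rewrite lee_fin.
  exact: rayleigh_ge0.
apply: ereal_sup_ubound; exists (fun=> (fun=> 0)) => // i.
exact: L2_cst.
Qed.

Lemma lambdabar_le (r : R) :
  (forall fs : 'I_n -> T -> R, (forall i, L2 mu (fs i)) -> exists f,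
    [/\ L2 mu f, ~ {ae mu, forall x, f x = 0}, forall i, ip mu f (fs i) = 0 &
      energy mu P f <= r * ip mu f f]) -> (lambdabar mu P n.+1 <= r%:E)%E.
Proof.
move=> h; apply: ge_ereal_sup => _ [fs Lfs <-].
have [f [Lf nf ffs en]] := h fs Lfs.
apply: (@le_trans _ _ (rayleigh mu P f)%:E).
  by apply: ereal_inf_lbound; exists f.
by rewrite lee_fin ler_pdivrMr // ip_gt0.
Qed.

(** Infinite dimension enters here: among [n + 1] independent functions some nonzero combination
    meets any [n] constraints, so the infimum is never over an empty set. Energy is at most twice
    the squared norm. *)
Lemma lambdabar_le2 : (lambdabar mu P n.+1 <= 2%:E)%E.
Proof.
apply: lambdabar_le => fs Lfs; have [g [Lg gfree]] := dimL2 n.+1.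
have [c [[i0 ci0] hc]] := kernel_vector (fun i j => ip mu (g i) (fs j)).
have Lf := L2_sum (index_enum 'I_n.+1) c Lg.
exists (fun x => \sum_i c i * g i x); split => //.
- by move=> /gfree/(_ i0) e; rewrite e eqxx in ci0.
- by move=> j; rewrite ip_suml ?hc.
- exact: energy_le.
Qed.

(** The worst ratio of a collection is attained at some index [i1], and the test function built from
    the pairs bounds [l] by [2 * (1 - ratio i1)]. *)
Lemma hbar_le (l : R) : lambdabar mu P n.+1 = l%:E ->
  (hbar mu P n.+1 <= (1 - l / 2)%:E)%E.
Proof.
move=> lE; apply: ge_ereal_sup => _ [[A B] /= adm <-].
pose ratio i : R := 2 * ip mu \1_(A i) (P \1_(B i)) / fine (mu (A i `|` B i)).
pose i1 := [arg min_(i < ord0) ratio i]%O.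
have i1min i : ratio i1 <= ratio i by rewrite /i1; case: arg_minP => // j _; apply.
apply: (@le_trans _ _ (ratio i1)%:E).
  by apply: ereal_inf_lbound; exists i1.
rewrite lee_fin.
have : (lambdabar mu P n.+1 <= (2 * (1 - ratio i1))%:E)%E.
  apply: lambdabar_le => fs Lfs.
  exact: (admissible_test_function PM PR adm Lfs i1min).
by rewrite lE lee_fin; lra.
Qed.

Lemma hbar_ge (l : R) : (lambdabar mu P n.+1 < l%:E)%E -> 0 < l ->
  ((1 - 77 * n.+1%:R ^+ 3 * Num.sqrt (2 * l))%:E <= hbar mu P n.+1)%E.
Proof.
move=> hl l0; have [A [B [adm hAB]]] := admissible_near_spectrum PM PR hl l0.
apply: (@le_trans _ _ (ereal_inf [set (2 * ip mu \1_(A i) (P \1_(B i)) /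
    fine (mu (A i `|` B i)))%:E | i in [set: 'I_n.+1]])).
  by apply: le_ereal_inf_tmp => _ [i _ <-]; rewrite lee_fin.
by apply: ereal_sup_ubound; exists (A, B).
Qed.

Lemma dual_cheeger_bounds :
  (((110 ^+ 2 * n.+1%:R ^+ 6)^-1)%:E *
     ((1%:E - hbar mu P n.+1) * (1%:E - hbar mu P n.+1))
     <= lambdabar mu P n.+1)%E /\
  (lambdabar mu P n.+1 <= 2%:E * (1%:E - hbar mu P n.+1))%E.
Proof.
have : lambdabar mu P n.+1 \is a fin_num.
  by rewrite ge0_fin_numE ?lambdabar_ge0 // (le_lt_trans lambdabar_le2) ?ltry.
move=> /fineK; set l := fine _ => lE.
have l0 : 0 <= l by rewrite -lee_fin lE lambdabar_ge0.
have hle := hbar_le (esym lE).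
(* The slack [e] supplies both the strict inequality and the positivity asked for by [hbar_ge], even
   when [l = 0]. *)
have hge (e : R) : 0 < e ->
    ((1 - 77 * n.+1%:R ^+ 3 * Num.sqrt (2 * (l + e)))%:E <= hbar mu P n.+1)%E.
  by move=> e0; apply: hbar_ge; rewrite -?lE ?lte_fin; lra.
have : hbar mu P n.+1 \is a fin_num.
  by rewrite fin_numE -ltNye -ltey (lt_le_trans _ (hge 1 ltr01)) ?ltNyr //=
    (le_lt_trans hle) ?ltry.
move=> /fineK; set h := fine _ => hE.
rewrite -hE lee_fin in hle; rewrite -lE -hE -EFinB -!EFinM !lee_fin; split; last by lra.
have k0 : 0 < n.+1%:R ^+ 6 :> R by rewrite exprn_gt0.
rewrite mulrC ler_pdivrMr ?mulr_gt0 ?exprn_gt0 //.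
(* Let [e] tend to 0; the error is [e] times the constant by which [l] is multiplied. *)
apply: (@le_eps_lin _ _ _ (110 ^+ 2 * n.+1%:R ^+ 6)).
  by rewrite mulr_ge0 // ltW.
move=> e e0 _; have := hge e e0; rewrite -hE lee_fin => he.
have s0 : 0 <= Num.sqrt (2 * (l + e)) by apply: sqrtr_ge0.
(* Squaring is legitimate because [h <= 1 - l / 2 <= 1]. *)
have : (1 - h) * (1 - h) <= (77 * n.+1%:R ^+ 3 * Num.sqrt (2 * (l + e))) ^+ 2.
  by rewrite expr2; apply: ler_pM; lra.
rewrite exprMn sqr_sqrtr ?mulr_ge0 ?addr_ge0 ?(ltW e0) // exprMn -exprM.
move=> /le_trans; apply; rewrite -mulrDl.
have -> : (77 ^+ 2 * n.+1%:R ^+ (3 * 2) * (2 * (l + e))) =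
   (l + e) * (77 ^+ 2 * 2 * n.+1%:R ^+ 6) :> R by ring.
rewrite ler_wpM2l ?addr_ge0 ?(ltW e0) // ler_wpM2r ?(ltW k0) //.
(* [2 * 77 ^ 2 = 11858] is at most [110 ^ 2 = 12100]. *)
lra.
Qed.
End Bounds.

Theorem theorem8p6 : exists C : Rdefinitions.R, 0 < C /\
  forall (d : measure_display) (T : measurableType d) (mu : probability T Rdefinitions.R)
    (P : (T -> Rdefinitions.R) -> (T -> Rdefinitions.R)),
    L2_infinite_dim mu -> markov_operator mu P -> reversible mu P ->
    forall k : nat, (1 <= k)%N ->
      (((C ^+ 2 * k%:R ^+ 6)^-1)%:E * ((1%:E - hbar mu P k) * (1%:E - hbar mu P k))
         <= lambdabar mu P k)%E /\
      (lambdabar mu P k <= 2%:E * (1%:E - hbar mu P k))%E.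
Proof.
exists 110; split => // d T mu P dimL2 PM PR [//|n] _.
exact: dual_cheeger_bounds.
Qed.
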